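(* Let $\sigma>0$, $\alpha>0$, and let $F:\mathcal{P}(\mathcal{X})\times\mathcal{P}(\mathcal{Y})\to\mathbb{R}$ satisfy the following three assumptions. (1) (Convexity-concavity) $F$ admits first order flat derivatives with respect to both $\nu$ and $\mu$, and for all $\nu,\nu'\in\mathcal{P}(\mathcal{X})$, $\mu,\mu'\in\mathcal{P}(\mathcal{Y})$, $$F(\nu',\mu)-F(\nu,\mu)\ge\int_{\mathcal{X}}\frac{\delta F}{\delta\nu}(\nu,\mu,x)(\nu'-\nu)(\mathrm{d}x),\qquad F(\nu,\mu')-F(\nu,\mu)\le\int_{\mathcal{Y}}\frac{\delta F}{\delta\mu}(\nu,\mu,y)(\mu'-\mu)(\mathrm{d}y).$$ (2) There exist $C_\nu,C_\mu>0$ such that $\left|\frac{\delta F}{\delta\nu}(\nu,\mu,x)\right|\le C_\nu$ and $\left|\frac{\delta F}{\delta\mu}(\nu,\mu,y)\right|\le C_\mu$ for all $(\nu,\mu)\in\mathcal{P}(\mathcal{X})\times\mathcal{P}(\mathcal{Y})$ and $(x,y)\in\mathcal{X}\times\mathcal{Y}$. (3) $F$ admits second order flat derivatives and there exist $C_{\nu,\nu},C_{\mu,\mu},C_{\nu,\mu},C_{\mu,\nu}>0$ such that $\left|\frac{\delta^2F}{\delta\nu^2}(\nu,\mu,x,x')\right|\le C_{\nu,\nu}$, $\left|\frac{\delta^2F}{\delta\mu^2}(\nu,\mu,y,y')\right|\le C_{\mu,\mu}$, $\left|\frac{\delta^2F}{\delta\nu\delta\mu}(\nu,\mu,y,x)\right|\le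 C_{\nu,\mu}$, $\left|\frac{\delta^2F}{\delta\mu\delta\nu}(\nu,\mu,x,y)\right|\le C_{\mu,\nu}$ for all $(\nu,\mu)\in\mathcal{P}(\mathcal{X})\times\mathcal{P}(\mathcal{Y})$ and $(x,y),(x',y')\in\mathcal{X}\times\mathcal{Y}$. Suppose that $(\nu_0,\mu_0)\in\mathcal{P}_{\mathrm{ac}}(\mathcal{X})\times\mathcal{P}_{\mathrm{ac}}(\mathcal{Y})$ are such that $\operatorname{D_{KL}}(\nu_0|\Psi_\sigma(\nu_0,\mu_0))+\operatorname{D_{KL}}(\mu_0|\Phi_\sigma(\nu_0,\mu_0))<\infty$, let $(\nu_t,\mu_t)_{t\ge0}$ be the mean-field best response (MF-BR) flow started at $(\nu_0,\mu_0)$, and let $(\nu^*_\sigma,\mu^*_\sigma)$ be the mixed Nash equilibrium of the game with payoff $V^\sigma$. Then, for all $t\ge0$, $$\operatorname{D_{KL}}(\nu_t|\nu^*_\sigma)+\operatorname{D_{KL}}(\mu_t|\mu^*_\sigma)\le e^{-\alpha t}\Big(\operatorname{D_{KL}}(\nu_0|\Psi_\sigma(\nu_0,\mu_0))+\operatorname{D_{KL}}(\mu_0|\Phi_\sigma(\nu_0,\mu_0))\Big),$$ $$\operatorname{TV}^2(\nu_t,\nu^*_\sigma)+\operatorname{TV}^2(\mu_t,\mu^*_\sigma)\le\frac12e^{-\alpha t}\Big(\operatorname{D_{KL}}(\nu_0|\Psi_\sigma(\nu_0,\mu_0))+\operatorname{D_{KL}}(\mu_0|\Phi_\sigma(\n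u_0,\mu_0))\Big).$$
   Context: Setting. $\mathcal{X},\mathcal{Y}\subseteq\mathbb{R}^d$; $U^\pi:\mathcal{X}\to\mathbb{R}$ and $U^\rho:\mathcal{Y}\to\mathbb{R}$ are measurable with $\int_{\mathcal{X}}e^{-U^\pi(x)}\mathrm{d}x=\int_{\mathcal{Y}}e^{-U^\rho(y)}\mathrm{d}y=1$; $\pi(x)=e^{-U^\pi(x)}$, $\rho(y)=e^{-U^\rho(y)}$. $\mathcal{P}(\mathcal{Z})$ is the set of probability measures on $\mathcal{Z}$ and $\mathcal{P}_{\mathrm{ac}}(\mathcal{Z})$ the subset of those absolutely continuous with respect to Lebesgue measure; a measure and its density are denoted by the same symbol. $\operatorname{D_{KL}}(m|m')=\int\log\left(\frac{m(x)}{m'(x)}\right)m(x)\,\mathrm{d}x$ is the relative entropy ($+\infty$ if $m$ is not absolutely continuous with respect to $m'$). $\operatorname{TV}(P,Q)=\sup_A|P(A)-Q(A)|$ is the total variation distance. Flat derivatives. For $\mathcal{M}\subseteq\mathbb{R}^d$, $G:\mathcal{P}(\mathcal{M})\to\mathbb{R}$ admits a first order flat derivative if there is $\frac{\delta G}{\delta m}:\mathcal{P}(\mathcal{M})\times\mathcal{M}\to\mathbb{R}$, jointly continuous (weak topology on $\mathcal{P}(\mathcal{M})$), such that for each $m$ the function $\frac{\delta G}{\delta m}(m,\cdot)$ is bounded and, for all $m,m'$, $G(m')-G(m)=\int_0^1\int_{\mathcal{M}}\frac{\delta G}{\delta m}(m+\varepsilon(m'-m),x)(m'-m)(\mathrm{d}x)\mathrm{d}\varepsilon$;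 it is normalized by $\int_{\mathcal{M}}\frac{\delta G}{\delta m}(m,x)m(\mathrm{d}x)=0$. For $F$ on $\mathcal{P}(\mathcal{X})\times\mathcal{P}(\mathcal{Y})$, $\frac{\delta F}{\delta\nu}(\nu,\mu,x)$ and $\frac{\delta F}{\delta\mu}(\nu,\mu,y)$ are the flat derivatives in the first and second argument. Second order flat derivatives are flat derivatives of first order ones with the point fixed: $\frac{\delta^2F}{\delta\nu^2}(\nu,\mu,x,\cdot)$ and $\frac{\delta^2F}{\delta\mu\delta\nu}(\nu,\mu,x,\cdot)$ are the flat derivatives in $\nu$, resp. $\mu$, of $\frac{\delta F}{\delta\nu}(\nu,\mu,x)$; $\frac{\delta^2F}{\delta\mu^2}(\nu,\mu,y,\cdot)$ and $\frac{\delta^2F}{\delta\nu\delta\mu}(\nu,\mu,y,\cdot)$ are those in $\mu$, resp. $\nu$, of $\frac{\delta F}{\delta\mu}(\nu,\mu,y)$. Game. $V^\sigma(\nu,\mu)=F(\nu,\mu)+\frac{\sigma^2}{2}(\operatorname{D_{KL}}(\nu|\pi)-\operatorname{D_{KL}}(\mu|\rho))$. A mixed Nash equilibrium (MNE) is a pair $(\nu^*_\sigma,\mu^*_\sigma)\in\mathcal{P}_{\mathrm{ac}}(\mathcal{X})\times\mathcal{P}_{\mathrm{ac}}(\mathcal{Y})$ with $V^\sigma(\nu^*_\sigma,\mu)\le V^\sigma(\nu^*_\sigma,\mu^*_\sigma)\le V^\sigma(\nu,\mu^*_\sigma)$ for all $(\nu,\mu)\in\mathcal{P}(\mathcal{X})\times\mathcal{P}(\mathcal{Y})$.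 Best responses. $\Psi_\sigma(\nu,\mu)$ and $\Phi_\sigma(\nu,\mu)$ are the probability measures on $\mathcal{X}$, $\mathcal{Y}$ with densities $$\Psi_\sigma(\nu,\mu)(x)=\tfrac{1}{Z(\nu,\mu)}\exp\left(-\tfrac{2}{\sigma^2}\tfrac{\delta F}{\delta\nu}(\nu,\mu,x)-U^\pi(x)\right),\quad\Phi_\sigma(\nu,\mu)(y)=\tfrac{1}{Z'(\nu,\mu)}\exp\left(\tfrac{2}{\sigma^2}\tfrac{\delta F}{\delta\mu}(\nu,\mu,y)-U^\rho(y)\right),$$ where $Z,Z'$ are normalizing constants. MF-BR flow. With learning rate $\alpha>0$, it is the unique flow $(\nu_t,\mu_t)_{t\ge0}$ in $\mathcal{P}_{\mathrm{ac}}(\mathcal{X})\times\mathcal{P}_{\mathrm{ac}}(\mathcal{Y})$ with the given initial condition satisfying, for $t\ge0$, $\mathrm{d}\nu_t(x)=\alpha(\Psi_\sigma(\nu_t,\mu_t)(x)-\nu_t(x))\mathrm{d}t$ and $\mathrm{d}\mu_t(y)=\alpha(\Phi_\sigma(\nu_t,\mu_t)(y)-\mu_t(y))\mathrm{d}t$ (existence and uniqueness hold under assumptions (2) and (3)). *)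

(* Defs.v *)
From HB Require Import structures.
From mathcomp Require Import all_boot all_order all_algebra.
From mathcomp Require Import all_classical all_reals all_analysis.
From mathcomp Require Import measurable_realfun.

Set Implicit Arguments.
Unset Strict Implicit.
Unset Printing Implicit Defensive.

Import Order.TTheory GRing.Theory Num.Theory.
Import numFieldNormedType.Exports.

Local Open Scope classical_set_scope.
Local Open Scope ring_scope.

Section borel_matrix.
Variables (R : realType) (m n : nat).
Local Notation T := 'M[R]_(m, n).
Local Notation G := (@open T).

Local Lemma borel0 : <<s G >> set0. Proof. exact: sigma_algebra0. Qed.
Local Lemma borelC (A : set T) : <<s G >> A -> <<s G >> (~` A).
Proof. by move=> sGA; rewrite -setTD; exact: sigma_algebraCD. Qed.
Local Lemma borelU (A : (set T)^nat) :
  (forall i, <<s G >> (A i)) -> <<s G >> (\bigcup_i A i).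
Proof. exact: sigma_algebra_bigcup. Qed.

HB.instance Definition _ := @isMeasurable.Build (sigma_display G) T <<s G >>
  borel0 borelC borelU.

End borel_matrix.


Section lebesgue_Rn.
Variable R : realType.
Local Notation tup n := (n.-tuple (measurableTypeR R)).

Definition tcons n (p : measurableTypeR R * tup n) : tup n.+1 :=
  [tuple of p.1 :: p.2].

Lemma measurable_tcons n :
  measurable_fun [set: measurableTypeR R * tup n] (@tcons n).
Proof. exact: measurable_cons. Qed.

Section step.
Variables (n : nat) (m : {sigma_finite_measure set (tup n) -> \bar R}).

Definition leb_step : set (tup n.+1) -> \bar R :=
  pushforward (@lebesgue_measure R \x m)%E (@tcons n).

Let leb_step0 : leb_step set0 = 0%E.
Proof. by rewrite /leb_step /pushforward preimage_set0 measure0. Qed.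

Let leb_step_ge0 A : (0 <= leb_step A)%E.
Proof. by rewrite /leb_step /pushforward measure_ge0. Qed.

Let leb_step_sigma_additive : semi_sigma_additive leb_step.
Proof.
pose P := @measure_function_pushforward__canonical__measure_function_Measure
  _ _ _ _ R (@lebesgue_measure R \x m)%E _ (@measurable_tcons n).
exact: (@measure_semi_sigma_additive _ _ _ P).
Qed.

HB.instance Definition _ := isMeasure.Build _ _ _ leb_step
  leb_step0 leb_step_ge0 leb_step_sigma_additive.

Let leb_step_sigma_finite : sigma_finite setT leb_step.
Proof.
have /sigma_finiteP[F [TF ndF Foo]] := sigma_finiteT (@lebesgue_measure R).
have /sigma_finiteP[G [TG ndG Goo]] := sigma_finiteT m.
pose g (t : tup n.+1) :=
  (thead t : measurableTypeR R, [tuple of behead t] : tup n).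
have mg : measurable_fun setT g.
  by apply/measurable_fun_pairP; split;
    [exact: measurable_tnth|exact: measurable_behead].
have gK p : g (tcons p) = p.
  by case: p => x t; congr (_, _); apply/val_inj.
exists (fun i => g @^-1` (F i `*` G i)).
  rewrite -preimage_bigcup (_ : \bigcup_i _ = setT) ?preimage_setT//.
  rewrite -setXTT TF TG; apply/seteqP; split => [[x y] [k _ [Fx Gy]]|[x y]].
    by split; exists k.
  move=> [[k _ /= Fkx] [l _ /= Gly]]; exists (maxn k l) => //; split => /=.
  - by move: x Fkx; exact/subsetPset/ndF/leq_maxl.
  - by move: y Gly; exact/subsetPset/ndG/leq_maxr.
move=> k; have [mF Fk] := Foo k; have [mG Gk] := Goo k; split.
  by rewrite -[X in measurable X]setTI; apply: mg => //; exact: measurableX.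
rewrite /leb_step /pushforward -comp_preimage (_ : g \o _ = id).
  rewrite preimage_id product_measure1E//.
  by rewrite lte_mul_pinfty// ge0_fin_numE.
by apply/funext => p; exact: gK.
Qed.

HB.instance Definition _ := Measure_isSigmaFinite.Build _ _ _ leb_step
  leb_step_sigma_finite.

End step.

Fixpoint leb_tuple n : {sigma_finite_measure set (tup n) -> \bar R} :=
  if n is n'.+1 then leb_step (leb_tuple n')
  else dirac ([tuple] : tup 0).

Definition row_of n (t : tup n) : 'rV[R]_n := \row_i tnth t i.

Lemma measurable_row_of n : measurable_fun [set: tup n] (@row_of n).
Proof.
apply: (@measurability _ _ _ _ _ _ (@open 'rV[R]_n)) => //.
move=> _ [U oU <-]; rewrite setTI.
pose box (q : {ffun 'I_n -> rat * rat}) : set (tup n) :=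
  [set t | forall i, ratr (q i).1 < tnth t i < ratr (q i).2].
have mbox q : measurable (box q).
  have -> : box q = \bigcap_(i : 'I_n)
      ((@tnth _ _ ^~ i) @^-1` `](ratr (q i).1 : R), ratr (q i).2[%classic).
    apply/seteqP; split => t /=; first by move=> h i _ /=; rewrite in_itv/=; exact: h.
    by move=> h i; have := h i I; rewrite /= in_itv.
  apply: (@fin_bigcap_measurable _ _ 'I_n setT); first exact: finite_finset.
  move=> i _; rewrite -[X in measurable X]setTI; apply: measurable_tnth => //.
have -> : @row_of n @^-1` U =
    \bigcup_(q in [set q | box q `<=` @row_of n @^-1` U]) box q.
  apply/seteqP; split => [t /= Ut|t [q/= qU /qU //]].
  have /= [P Pt PU] := oU _ Ut.
  have ex (i : 'I_n) : exists q : rat * rat,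
      (ratr q.1 < tnth t i < ratr q.2) /\
      forall y : R, ratr q.1 < y < ratr q.2 -> P ord0 i y.
    have := Pt ord0 i; rewrite mxE => /nbhs_ballP[e/= e0 eP].
    have lt1 : tnth t i - e < tnth t i by rewrite ltrBlDr ltrDl.
    have lt2 : tnth t i < tnth t i + e by rewrite ltrDl.
    have [a /=] := @rat_in_itvoo R _ _ lt1.
    have [b /=] := @rat_in_itvoo R _ _ lt2.
    rewrite !in_itv/= => /andP[b1 b2] /andP[a1 a2].
    exists (a, b) => /=; rewrite a2 b1; split => // y /andP[ay yb].
    apply: eP; rewrite /ball/= ltr_norml; apply/andP; split.
      by rewrite ltrBrDr addrC ltrBlDr; exact: lt_trans yb b2.
    by rewrite ltrBlDr -ltrBlDl; exact: lt_trans a1 ay.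
  pose q := [ffun i => projT1 (cid (ex i))].
  have qP i := projT2 (cid (ex i)).
  exists q => /=.
    move=> s qs /=; apply: PU => i j; rewrite ord1 mxE; apply: (qP j).2.
    by have := qs j; rewrite ffunE.
  by move=> i; rewrite ffunE; exact: (qP i).1.
rewrite bigcup_mkcond; apply: countable_bigcupT_measurable => // q.
by case: ifP.
Qed.

Definition lebesgue_Rn n : set 'rV[R]_n -> \bar R :=
  pushforward (leb_tuple n) (@row_of n).

Section lebesgue_Rn_measure.
Variable n : nat.
Local Notation mu := (@lebesgue_Rn n).

Let mu0 : mu set0 = 0%E.
Proof. by rewrite /lebesgue_Rn /pushforward preimage_set0 measure0. Qed.

Let mu_ge0 A : (0 <= mu A)%E.
Proof. by rewrite /lebesgue_Rn /pushforward measure_ge0. Qed.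

Let mu_sigma_additive : semi_sigma_additive mu.
Proof.
pose P := @measure_function_pushforward__canonical__measure_function_Measure
  _ _ _ _ R (leb_tuple n) _ (@measurable_row_of n).
exact: (@measure_semi_sigma_additive _ _ _ P).
Qed.

HB.instance Definition _ := isMeasure.Build _ _ _ mu
  mu0 mu_ge0 mu_sigma_additive.

Let mu_sigma_finite : sigma_finite setT mu.
Proof.
have /sigma_finiteP[F [TF ndF Foo]] := sigma_finiteT (leb_tuple n).
pose g (x : 'rV[R]_n) : tup n := [tuple x ord0 i | i < n].
have gK t : g (row_of t) = t.
  by apply: eq_from_tnth => i; rewrite tnth_mktuple mxE.
have mcoord (i : 'I_n) :
    measurable_fun setT (fun x : 'rV[R]_n => x ord0 i : measurableTypeR R).
  apply: (measurability _ (@RGenOpens.measurableE R)).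
  move=> _ [_ [a [b ->] <-]]; rewrite setTI; apply: sub_sigma_algebra.
  have /continuousP := @coord_continuous R 1 n ord0 i; apply.
  exact: interval_open.
have mg : measurable_fun setT g.
  apply/measurable_fun_tnthP => i.
  rewrite (_ : (_ \o _) = (fun x : 'rV[R]_n => x ord0 i)); first exact: mcoord.
  by apply/funext => x /=; rewrite tnth_mktuple.
exists (fun i => g @^-1` F i).
  by rewrite -preimage_bigcup -TF preimage_setT.
move=> k; have [mF Fk] := Foo k; split.
  by rewrite -[X in measurable X]setTI; exact: mg.
rewrite /lebesgue_Rn /pushforward -comp_preimage (_ : g \o _ = id) ?preimage_id//.
by apply/funext => t; exact: gK.
Qed.

HB.instance Definition _ := Measure_isSigmaFinite.Build _ _ _ mu
  mu_sigma_finite.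

End lebesgue_Rn_measure.

Lemma leb_tuple_box n (A : 'I_n -> set (measurableTypeR R)) :
  (forall i, measurable (A i)) ->
  leb_tuple n [set t | forall i, A i (tnth t i)] =
  (\prod_(i < n) lebesgue_measure (A i))%E.
Proof.
elim: n A => [|n IH] A mA.
  rewrite big_ord0/= /dirac indicE mem_set//.
  by case.
rewrite big_ord_recl/= /leb_step /pushforward -IH; last by move=> i; exact: mA.
rewrite -product_measure1E//; last first.
  rewrite (_ : mkset _ =
      \bigcap_(i : 'I_n) (@tnth _ _ ^~ i) @^-1` A (lift ord0 i)).
    apply: (@fin_bigcap_measurable _ _ 'I_n setT); first exact: finite_finset.
    by move=> i _; rewrite -[X in measurable X]setTI; exact: measurable_tnth.
  by apply/seteqP; split => t h i; [move=> _; exact: h|exact: (h i I)].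
congr (_ _); apply/seteqP; split => [[x t] /= h|[x t] /= [Ax At] i].
  split; first by have := h ord0.
  by move=> i; have := h (lift ord0 i); rewrite /tcons tnthS.
case: (unliftP ord0 i) => [j ->|->//]; rewrite /tcons tnthS; exact: At.
Qed.

Lemma lebesgue_Rn_box n (a b : 'rV[R]_n) : (forall i, a ord0 i <= b ord0 i) ->
  lebesgue_Rn [set x : 'rV[R]_n | forall i, a ord0 i <= x ord0 i <= b ord0 i] =
  (\prod_(i < n) (b ord0 i - a ord0 i))%:E.
Proof.
move=> ab; rewrite /lebesgue_Rn /pushforward.
transitivity (\prod_(i < n) @lebesgue_measure R `[a ord0 i, b ord0 i]%classic)%E.
  rewrite -leb_tuple_box; last by move=> i; exact: measurable_itv.
  congr (_ _); apply/seteqP; split => t /= h i; have := h i.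
    by rewrite mxE in_itv.
  by rewrite mxE in_itv.
rewrite -prodEFin; apply: eq_bigr => i _; rewrite lebesgue_measure_itv/= lte_fin.
have := ab i; rewrite le_eqVlt => /predU1P[->|->//].
by rewrite ltxx subrr.
Qed.

End lebesgue_Rn.

Section prob_on.
Variables (R : realType) (d : nat).
Implicit Types M : set 'rV[R]_d.

(* A Borel probability measure on a Borel set M is encoded as a Borel
   probability measure on R^d that gives mass 1 to M.  Measures of the library
   are functions on all sets, so two elements of Prob M that agree on Borel sets
   need not be equal; they are topologically indistinguishable for the weak
   topology below. *)
Record Prob M := MkProb {
  prob_val :> probability 'rV[R]_d R ;
  prob_supp : prob_val M = 1%E }.

HB.instance Definition _ M := gen_eqMixin (Prob M).
HB.instance Definition _ M := gen_choiceMixin (Prob M).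

Definition bounded_on M (f : 'rV[R]_d -> R) : Prop :=
  exists K : R, forall x, M x -> `|f x| <= K.

Definition Cb M :=
  {f : 'rV[R]_d -> R | {within M, continuous f} /\ bounded_on M f}.

HB.instance Definition _ M := gen_eqMixin (Cb M).
HB.instance Definition _ M := gen_choiceMixin (Cb M).

Definition prob_eval M (m : Prob M) : prod_topology (fun _ : Cb M => R) :=
  fun f => \int[m]_(x in M) sval f x.

(* weak topology: the coarsest one making m |-> \int f dm continuous for every
   bounded continuous f on M *)
HB.instance Definition _ M :=
  Topological.copy (Prob M) (initial_topology (@prob_eval M)).

Section mix.
Variables (M : set 'rV[R]_d) (e : R) (m m' : Prob M).

(* Truncation to [0, 1], so that the mixture below is defined for every real
   weight; only weights in [0, 1] are used. *)
Definition weight : R := Num.min 1 (Num.max 0 e).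

Lemma weight_ge0 : 0 <= weight.
Proof. by rewrite /weight le_min ler01 le_max lexx. Qed.

Lemma weight_le1 : 0 <= 1 - weight.
Proof. by rewrite subr_ge0 /weight ge_min lexx. Qed.

Definition mix_measure : set 'rV[R]_d -> \bar R :=
  measure_add (mscale (NngNum weight_le1) m) (mscale (NngNum weight_ge0) m').

Lemma mix_measureE A :
  mix_measure A = ((1 - weight)%:E * m A + weight%:E * m' A)%E.
Proof. by rewrite /mix_measure measure_addE. Qed.

HB.instance Definition _ := Measure.on mix_measure.

Let mix_setT : mix_measure setT = 1%E.
Proof. by rewrite mix_measureE !probability_setT !mule1 -EFinD subrK. Qed.

HB.instance Definition _ :=
  Measure_isProbability.Build _ _ _ mix_measure mix_setT.

Lemma mix_supp : mix_measure M = 1%E.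
Proof. by rewrite mix_measureE !prob_supp !mule1 -EFinD subrK. Qed.

Definition mix : Prob M := MkProb mix_supp.

End mix.

(* The last clause normalizes D, which makes it unique on Prob M * M. *)
Definition is_flat_derivative M (G : Prob M -> R)
    (D : Prob M -> 'rV[R]_d -> R) : Prop :=
  [/\ {within [set: Prob M] `*` M,
        continuous (fun p : Prob M * 'rV[R]_d => D p.1 p.2)},
      forall m : Prob M, bounded_on M (D m),
      forall m m' : Prob M, G m' - G m =
        \int[lebesgue_measure]_(e in `[0, 1]%classic)
          (\int[m']_(x in M) D (mix e m m') x -
           \int[m]_(x in M) D (mix e m m') x)
    & forall m : Prob M, \int[m]_(x in M) D m x = 0].

Definition Pac M (m : Prob M) : Prop := m `<< @lebesgue_Rn R d.

Definition is_density M (m : Prob M) (p : 'rV[R]_d -> R) : Prop :=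
  [/\ measurable_fun M p, forall x, M x -> 0 <= p x
    & forall A, measurable A -> A `<=` M ->
        m A = (\int[@lebesgue_Rn R d]_(x in A) (p x)%:E)%E].

Definition density (m : probability 'rV[R]_d R) (x : 'rV[R]_d) : R :=
  fine (Radon_Nikodym (charge_of_finite_measure m) (@lebesgue_Rn R d) x).

(* The formula is meant for m' absolutely continuous with respect to Lebesgue
   measure, in which case m `<< m' gives m a Lebesgue density too.  Where
   density m vanishes the integrand is 0. *)
Definition KL (m m' : probability 'rV[R]_d R) : \bar R :=
  if `[< m `<< m' >] then
    (\int[@lebesgue_Rn R d]_x
      (ln (density m x / density m' x) * density m x)%:E)%E
  else +oo%E.

Definition TV (m m' : probability 'rV[R]_d R) : R :=
  sup [set `|fine (m A) - fine (m' A)| | A in measurable].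

Definition gibbs_density M (h : 'rV[R]_d -> R) (x : 'rV[R]_d) : R :=
  expR (h x) / \int[@lebesgue_Rn R d]_(y in M) expR (h y).

Definition gibbs M (m0 : Prob M) (h : 'rV[R]_d -> R) : Prob M :=
  xget m0 [set m | is_density m (gibbs_density M h)].


Definition density_measure M (p : 'rV[R]_d -> R) : set 'rV[R]_d -> \bar R :=
  fun A => (\int[@lebesgue_Rn R d]_(x in A `&` M) (p x)%:E)%E.

Section gibbs_exists.
Variables (M : set 'rV[R]_d) (m0 : Prob M) (h : 'rV[R]_d -> R).
Hypotheses (mM : measurable M) (mh : measurable_fun M h).
Hypothesis Zoo : (\int[@lebesgue_Rn R d]_(x in M) (expR (h x))%:E < +oo)%E.
Hypothesis Z0 : (0 < \int[@lebesgue_Rn R d]_(x in M) (expR (h x))%:E)%E.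

Local Notation leb := (@lebesgue_Rn R d).
Local Notation p := (gibbs_density M h).

Let Z0' : 0 < \int[leb]_(y in M) expR (h y).
Proof. by rewrite /Rintegral fine_gt0// Z0 Zoo. Qed.

Let p_ge0 x : 0 <= p x.
Proof. by rewrite divr_ge0 ?expR_ge0// ltW. Qed.

Let mp : measurable_fun M p.
Proof. by apply: measurable_funM => //; exact: measurableT_comp. Qed.

Local Notation q := (density_measure M p).

Let q0 : q set0 = 0%E. Proof. by rewrite /density_measure set0I integral_set0. Qed.

Let q_ge0 A : (0 <= q A)%E.
Proof. by apply: integral_ge0 => x _; rewrite lee_fin. Qed.

Let q_sigma_additive : semi_sigma_additive q.
Proof.
move=> F mF tF mUF; rewrite /density_measure setI_bigcupl ge0_integral_bigcup//=.
- apply: is_cvg_ereal_nneg_natsum_cond => n _ _.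
  by apply: integral_ge0 => x _; rewrite lee_fin.
- by move=> n; exact: measurableI.
- rewrite -setI_bigcupl; apply/measurable_EFinP; exact: measurable_funS mp.
- by move=> x _; rewrite lee_fin.
- apply/trivIsetP => i j _ _ ij; rewrite setIACA setIid.
  by move/trivIsetP : tF => ->//; rewrite set0I.
Qed.

HB.instance Definition _ := isMeasure.Build _ _ _ q q0 q_ge0 q_sigma_additive.

Let qM : q M = 1%E.
Proof.
rewrite /density_measure setIid /gibbs_density.
under eq_integral do rewrite EFinM muleC.
rewrite ge0_integralZl//.
- rewrite -[X in (_ * X)%E]fineK ?ge0_fin_numE ?(ltW Z0)//.
  by rewrite -EFinM mulVf// gt_eqF.
- by apply/measurable_EFinP; exact: measurableT_comp.
- by rewrite lee_fin invr_ge0 ltW.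
Qed.

Let qT : q setT = 1%E.
Proof. by rewrite -qM /density_measure setTI setIid. Qed.

HB.instance Definition _ := Measure_isProbability.Build _ _ _ q qT.

(* The defining property of gibbs holds as soon as the normalizing constant is
   positive and finite; its default value m0 is then irrelevant. *)
Lemma gibbsP : is_density (gibbs m0 h) p.
Proof.
apply: (xgetPex m0 (P := [set m | is_density m p])).
exists (@MkProb M q qM); split => // A mA AM.
by rewrite /= /density_measure (setIidl AM).
Qed.

End gibbs_exists.

End prob_on.

Section game.
Variables (R : realType) (d : nat) (X Y : set 'rV[R]_d).
Variables (sigma : R).
Implicit Types (nu : Prob X) (mu : Prob Y).

(* At an equilibrium both entropies are finite, so the value given by the
   library to +oo - +oo below plays no role in is_MNE. *)
Definition payoff (F : Prob X -> Prob Y -> R)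
    (ppi : Prob X) (prho : Prob Y) nu mu : \bar R :=
  ((F nu mu)%:E + (sigma ^+ 2 / 2)%:E * (KL nu ppi - KL mu prho))%E.

Definition is_MNE (V : Prob X -> Prob Y -> \bar R) (nus : Prob X) (mus : Prob Y)
  : Prop :=
  [/\ Pac nus, Pac mus
    & forall nu mu, (V nus mu <= V nus mus)%E /\ (V nus mus <= V nu mus)%E].

Variables (Upi Urho : 'rV[R]_d -> R).
Variables (DnuF DmuF : Prob X -> Prob Y -> 'rV[R]_d -> R).

Definition Psi_exponent nu mu x : R := - (2 / sigma ^+ 2) * DnuF nu mu x - Upi x.
Definition Phi_exponent nu mu y : R := 2 / sigma ^+ 2 * DmuF nu mu y - Urho y.

Definition Psi nu mu : Prob X := gibbs nu (Psi_exponent nu mu).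
Definition Phi nu mu : Prob Y := gibbs mu (Phi_exponent nu mu).

(* one-sided derivative at t = 0 *)
Definition has_derivative_on_nonneg (f : R -> R) (t l : R) : Prop :=
  ((s - t)^-1 * (f s - f t)) @[s --> within [set s | 0 <= s] t^'] --> l.

(* n t and m t are versions of the densities of nu t and mu t for which the
   flow equations hold at every point of X and Y. *)
Definition is_MFBR_flow (alpha : R) (nu0 : Prob X) (mu0 : Prob Y)
    (nu : R -> Prob X) (mu : R -> Prob Y) : Prop :=
  [/\ forall A, measurable A -> nu 0 A = nu0 A /\ mu 0 A = mu0 A,
      forall t, 0 <= t -> Pac (nu t) /\ Pac (mu t)
    & exists n m : R -> 'rV[R]_d -> R,
      [/\ forall t, 0 <= t -> is_density (nu t) (n t) /\ is_density (mu t) (m t),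
          forall t x, 0 <= t -> X x ->
            has_derivative_on_nonneg (n ^~ x) t
              (alpha * (gibbs_density X (Psi_exponent (nu t) (mu t)) x - n t x))
        & forall t y, 0 <= t -> Y y ->
            has_derivative_on_nonneg (m ^~ y) t
              (alpha * (gibbs_density Y (Phi_exponent (nu t) (mu t)) y - m t y))]].

End game.

(* Main.v *)
Require Import Defs.
From HB Require Import structures.
From mathcomp Require Import all_boot all_order all_algebra.
From mathcomp Require Import all_classical all_reals all_analysis.
From mathcomp Require Import measurable_realfun ring lra.

Set Implicit Arguments.
Unset Strict Implicit.
Unset Printing Implicit Defensive.

Import Order.TTheory GRing.Theory Num.Theory.
Import numFieldNormedType.Exports.

Local Open Scope classical_set_scope.
Local Open Scope ring_scope.

(* Tilting a reference measure exp (- U) by a bounded potential g changes relative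
   entropies by an affine functional: KL (m | Gamma g) = KL (m | Gamma 0) + int g dm + ln Z(g),
   where Gamma g = exp (- g - U) / Z(g).  With KL >= 0 this gives, for two potentials,
     KL (m | Gamma g') <= KL (m | Gamma g) + int (g' - g) dm - int (g' - g) d(Gamma g').
   Apply it to both players and add: the corrections combine into the monotonicity form
   of the pair (dF/dnu, - dF/dmu), which has a sign by convexity-concavity.  At the
   equilibrium, which is a fixed point of the best responses, this bounds
   KL (nu | nu^* ) + KL (mu | mu^* ) by the Lyapunov function
   V (nu, mu) = KL (nu | Psi (nu, mu)) + KL (mu | Phi (nu, mu)).

   Decay of V needs no differentiation of V.  By the mean value theorem the flow over a
   step h is a mixture, with weight l = 1 - exp (- alpha h), of the old density and of a
   best response at an intermediate time, which is within a factor 1 + O(h) of the one at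
   the final time, because the second flat derivatives are bounded.  Convexity of the
   relative entropy and the inequality above, with Delta nu = l (Psi - nu) + O(h l), give
   V (t + h) <= exp (- alpha h) V (t) + O(h^2), uniformly in t; iterate and let h tend
   to 0.  The bound in total variation is Pinsker's inequality. *)

(** * Elementary inequalities *)

Section entropy_function.
Context {R : realType}.
Implicit Types p q n r f l eta : R.

(* On probability densities the terms - p + q integrate to 0; they make the
   integrand of the relative entropy nonnegative. *)
Definition ent p q : R := p * ln (p / q) - p + q.

(** Fenchel-Young inequality for the entropy, with equality at f = ln (p / q). It is exp u >= 1 + u
    at u = f - ln (p / q), multiplied by p; the convexity and Pinsker bounds below both come from
    it. *)
Lemma ent_young p q f : 0 <= p -> 0 < q -> p * f - q * expR f + q <= ent p q.
Proof.
rewrite /ent le_eqVlt => /predU1P[<-|p0] q0.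
  have : 0 < q * expR f by rewrite mulr_gt0 ?expR_gt0.
  by rewrite !mul0r; lra.
have E : q * expR f = p * expR (f - ln (p / q)).
  rewrite expRD expRN lnK ?posrE ?divr_gt0//.
  by field; rewrite !gt_eqF.
have := expR_ge1Dx (f - ln (p / q)).
rewrite -(ler_pM2l p0) -E => H; nra.
Qed.

Lemma ent_ge0 p q : 0 <= p -> 0 < q -> 0 <= ent p q.
Proof. by move=> p0 q0; have := ent_young 0 p0 q0; rewrite expR0; lra. Qed.

Lemma ent_id q : 0 < q -> ent q q = 0.
Proof. by move=> q0; rewrite /ent divff ?gt_eqF// ln1 mulr0; lra. Qed.

(** The bound ln u <= u - 1 at u = r / q dominates the entropy by the chi-square integrand (r - q)^2
    / q, hence an error quadratic in [eta]. *)
Lemma ent_close r q eta : 0 <= r -> 0 < q -> `|r - q| <= eta * q ->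
  ent r q <= eta ^+ 2 * q.
Proof.
move=> r0 q0 rq; apply: (@le_trans _ _ ((r - q) ^+ 2 / q)); last first.
  rewrite ler_pdivrMr// -mulrA -expr2 -exprMn -real_normK ?num_real//.
  by rewrite ler_sqr// nnegrE; apply: le_trans rq.
have -> : (r - q) ^+ 2 / q = r * (r / q - 1) - r + q by field; rewrite gt_eqF.
rewrite /ent !lerD2r; move: r0; rewrite le_eqVlt => /predU1P[<-|r0].
  by rewrite !mul0r.
rewrite ler_pM2l//; have := @le_ln1Dx R (r / q - 1).
by rewrite subrKC; apply; rewrite ltrBrDr addrC subrr divr_gt0.
Qed.

(** Apply [ent_young] to n and to r with the f that is optimal for the mixture p, and average: the
    right side becomes exactly [ent p q]. If p = 0 then n = r = 0. *)
Lemma ent_convex n r q l : 0 <= n -> 0 <= r -> 0 < q -> 0 < l -> l < 1 ->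
  ent ((1 - l) * n + l * r) q <= (1 - l) * ent n q + l * ent r q.
Proof.
move=> n0 r0 q0 l0 l1; set p := (_ + _).
have p0 : 0 <= p by rewrite addr_ge0// mulr_ge0//; lra.
move: (p0); rewrite le_eqVlt => /predU1P[pE|pgt0].
  have : (1 - l) * n = 0 /\ l * r = 0.
    have : 0 <= (1 - l) * n by apply: mulr_ge0 => //; lra.
    have : 0 <= l * r by apply: mulr_ge0 => //; lra.
    by move: pE; rewrite /p; split; lra.
  move=> [/eqP + /eqP].
  rewrite !mulf_eq0 (gt_eqF l0) subr_eq0 (gt_eqF l1)/= => /eqP -> /eqP ->.
  by rewrite -pE; lra.
have Yn := ent_young (ln (p / q)) n0 q0.
have Yr := ent_young (ln (p / q)) r0 q0.
rewrite lnK ?posrE ?divr_gt0// (_ : q * (p / q) = p) in Yn Yr; last first.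
  by field; rewrite gt_eqF.
have l1' : 0 < 1 - l by lra.
have H1 : (1 - l) * (n * ln (p / q) - p + q) <= (1 - l) * ent n q by rewrite ler_pM2l.
have H2 : l * (r * ln (p / q) - p + q) <= l * ent r q by rewrite ler_pM2l.
have -> : ent p q = (1 - l) * (n * ln (p / q) - p + q) + l * (r * ln (p / q) - p + q).
  by rewrite /ent {1}/p; ring.
lra.
Qed.

Lemma ent_change n w q z : 0 <= n -> 0 < w ->
  q = w * expR (- z) -> ent n q = ent n w + n * z + (q - w).
Proof.
move=> n0 w0 ->; rewrite /ent; move: n0; rewrite le_eqVlt => /predU1P[<-|n0].
  by rewrite !mul0r; ring.
rewrite invfM -expRN opprK mulrA lnM ?posrE ?expR_gt0 ?divr_gt0// expRK; ring.
Qed.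

End entropy_function.

Section exp_bounds.
Context {R : realType}.
Implicit Types u d Q s : R.

Lemma expR_sub1_le u d : `|u| <= d -> d <= 2^-1 -> `|expR u - 1| <= 2 * d.
Proof.
rewrite ler_norml => /andP[ud1 ud2] d2.
have d0 : 0 <= d by lra.
have H1 := expR_ge1Dx u; have H2 := expR_ge1Dx (- u).
have u0 := expR_gt0 u.
have H : expR u * (1 - u) <= 1.
  by rewrite -[leRHS](expRxMexpNx_1 u) ler_pM2l.
rewrite ler_norml; apply/andP; split; first by clear H H2; lra.
clear H2; nra.
Qed.

Lemma is_derive_le (f df : R -> R) (s : R) : 0 <= s ->
  (forall x : R, is_derive x 1 f (df x)) -> (forall x : R, 0 <= x -> 0 <= df x) ->
  f 0 <= f s.
Proof.
move=> s0 fd df0.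
have [c|c] := @MVT_segment R f df 0 s s0 (fun x _ => fd x).
  apply: derivable_within_continuous => x _; by case: (fd x).
rewrite in_itv/= => /andP[c0 _] E.
by rewrite -subr_ge0 E subr0 mulr_ge0// df0.
Qed.

(** Let G be the exponent on the right minus the logarithm of the left side. Then G and G' vanish at
    0, and G'' = 1/4 - theta (1 - theta) >= 0, where theta = Q exp x / D x is the tilted success
    probability. *)
Lemma hoeffding_bernoulli Q s : 0 <= Q -> Q <= 1 -> 0 <= s ->
  1 - Q + Q * expR s <= expR (Q * s + s ^+ 2 / 8).
Proof.
move=> Q0 Q1 s0.
pose D x : R := 1 - Q + Q * expR x.
have D0 x : 0 < D x.
  have := expR_gt0 x; rewrite /D => ex.
  have [->|Qn] := eqVneq Q 0; first by rewrite subr0 mul0r addr0.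
  have Qp : 0 < Q by rewrite lt_def Qn.
  by rewrite ltr_wpDl ?subr_ge0// mulr_gt0.
have dD (x : R) : is_derive x 1 D (Q * expR x).
  rewrite /D; apply: is_derive_eq; rewrite /GRing.scale/=; ring.
pose u x : R := Q + x / 4 - Q * expR x / D x.
have u0 x : 0 <= x -> 0 <= u x.
  move=> x0.
  suff : u 0 <= u x by rewrite /u /D expR0 mul0r addr0 mulr1 subrK divr1 subrr.
  apply: (@is_derive_le u (fun x => 4^-1 - (Q * expR x * (1 - Q)) / D x ^+ 2) x x0) => y.
    have Dn : D y != 0 by rewrite gt_eqF.
    rewrite /u; apply: is_derive_eq.
    rewrite /GRing.scale/= [in RHS](_ : 1 - Q = D y - Q * expR y); last first.
      by rewrite /D addrK.
    by move: (D y) (expR y) Dn {dD u} => e f e0; field.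
  move=> y0; rewrite subr_ge0 ler_pdivrMr ?exprn_gt0// /D.
  have := sqr_ge0 (Q * expR y - (1 - Q)); nra.
suff : 0 <= Q * s + s ^+ 2 / 8 - ln (D s).
  by rewrite subr_ge0 -ler_expR lnK ?posrE.
pose G (x : R) : R := Q * x + x ^+ 2 / 8 - ln (D x).
suff : G 0 <= G s.
  by rewrite /G /D expR0 mulr1 subrK ln1 expr0n/= !(mulr0,mul0r) addr0 subr0.
apply: (@is_derive_le G u s s0 _ u0) => x.
have dlnD : is_derive x 1 (fun x => ln (D x)) ((D x)^-1 * (Q * expR x)).
  by apply: is_derive1_comp; exact: is_derive1_ln.
rewrite /G /u; apply: is_derive_eq; rewrite /GRing.scale/=.
have : D x != 0 by rewrite gt_eqF.
by move: (D x) (expR x) => e f e0; field.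
Qed.

End exp_bounds.

(** * Integration *)

Section integral_complements.
Context d (T : measurableType d) (R : realType).
Variable mu : {measure set T -> \bar R}.
Implicit Types (D : set T) (f g : T -> R).

(** Since f need not be integrable, entropy identities obtained from this lemma include the value
    +oo. In that case the negative part of f + g is dominated by |g|, so only the positive part
    diverges. *)
Lemma ge0_integralD_integrable D f g : measurable D -> measurable_fun D f ->
  (forall x, D x -> 0 <= f x) -> mu.-integrable D (EFin \o g) ->
  (\int[mu]_(x in D) (f x + g x)%:E =
   \int[mu]_(x in D) (f x)%:E + \int[mu]_(x in D) (g x)%:E)%E.
Proof.
move=> mD mf f0 ig.
have mg : measurable_fun D g by apply/measurable_EFinP; exact: measurable_int ig.
have [fi|fi] := pselect (mu.-integrable D (EFin \o f)).
  by rewrite -integralD_EFin.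
have gfin : (\int[mu]_(x in D) (g x)%:E)%E \is a fin_num by exact: integrable_fin_num.
have mfg : measurable_fun D (fun x => (f x + g x)%:E).
  by apply/measurable_EFinP; exact: measurable_funD.
have foo : (\int[mu]_(x in D) (f x)%:E = +oo)%E.
  apply/eqP; rewrite -leye_eq leNgt; apply/negP => flt; apply: fi.
  apply/integrableP; split; first exact/measurable_EFinP.
  rewrite (eq_integral (EFin \o f))// => x /set_mem Dx /=.
  by rewrite ger0_norm// f0.
rewrite foo addye; last by apply: contraTneq gfin => ->.
have [_ g1] := integrableP _ _ _ ig.
pose h x := (f x + g x)%:E.
have neg : (\int[mu]_(x in D) h^\- x < +oo)%E.
  apply: le_lt_trans g1; apply: ge0_le_integral => //.
  - exact: measurable_funeneg.
  - by apply: measurableT_comp => //; exact/measurable_EFinP.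
  - move=> x Dx; rewrite funenegE /h -EFinN -EFin_max lee_fin ge_max normr_ge0.
    by rewrite andbT -normrN (le_trans _ (ler_norm _))// opprD gerDr oppr_le0 f0.
have pos : (\int[mu]_(x in D) h^\+ x = +oo)%E.
  apply/eqP; rewrite -leye_eq leNgt; apply/negP => hlt.
  suff : (\int[mu]_(x in D) (f x)%:E < +oo)%E by rewrite foo.
  apply: le_lt_trans (lte_add_pinfty hlt g1); rewrite -ge0_integralD//; last 2 first.
  - exact: measurable_funepos.
  - by apply: measurableT_comp => //; exact/measurable_EFinP.
  apply: ge0_le_integral => //.
  - exact/measurable_EFinP.
  - apply: emeasurable_funD; first exact: measurable_funepos.
    by apply: measurableT_comp => //; exact/measurable_EFinP.
  - move=> x Dx; rewrite funeposE /h -EFin_max -EFinD lee_fin.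
    rewrite -lerBlDr le_max; apply/orP; left.
    by rewrite lerD2l lerNl -normrN ler_norm.
by rewrite [LHS]integralE pos addye// -ltNye lteNr.
Qed.

(** The integral of a nonnegative function is a supremum over the simple functions below it, and a
    larger function has more of them; measurability does not enter. *)
Lemma ge0_le_integral_nonmeasurable D (f g : T -> \bar R) :
  (forall x, D x -> (0 <= f x)%E) -> (forall x, D x -> (f x <= g x)%E) ->
  (\int[mu]_(x in D) f x <= \int[mu]_(x in D) g x)%E.
Proof.
move=> f0 fg; have g0 x : D x -> (0 <= g x)%E.
  by move=> Dx; exact: le_trans (f0 _ Dx) (fg _ Dx).
rewrite !ge0_integralE//; apply: le_ereal_sup => _ [h hf <-]; exists h => // x.
apply: le_trans (hf x) _; rewrite /patch; case: ifPn => // /set_mem; exact: fg.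
Qed.

(** Meant for the integral over the mixing parameter in [is_flat_derivative], whose integrand is not
    shown to be measurable. The positive and negative parts each integrate to a value in
    [0, B mu(D)]. *)
Lemma normr_Rintegral_le_nonmeasurable D (f : T -> R) B :
  measurable D -> (mu D < +oo)%E -> (forall x, D x -> `|f x| <= B) ->
  `|\int[mu]_(x in D) f x| <= B * fine (mu D).
Proof.
move=> mD Doo fB.
have [->|/set0P[x0 Dx0]] := eqVneq D set0.
  by rewrite Rintegral_set0 measure0 mulr0 normr0.
have B0 : 0 <= B by exact: le_trans (fB _ Dx0).
have bound (g : T -> \bar R) : (forall x, D x -> (0 <= g x <= B%:E)%E) ->
    exists2 r, (\int[mu]_(x in D) g x)%E = r%:E & 0 <= r <= B * fine (mu D).
  move=> gB; have g0 : (0 <= \int[mu]_(x in D) g x)%E.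
    by apply: integral_ge0 => x /gB /andP[].
  have gle : (\int[mu]_(x in D) g x <= (B * fine (mu D))%:E)%E.
    rewrite EFinM fineK ?ge0_fin_numE// -integral_cst//.
    by apply: ge0_le_integral_nonmeasurable => x /gB /andP[].
  have gfin : (\int[mu]_(x in D) g x)%E \is a fin_num.
    by rewrite ge0_fin_numE// (le_lt_trans gle)// ltey.
  exists (fine (\int[mu]_(x in D) g x)%E); first by rewrite fineK.
  by rewrite -!lee_fin fineK// g0.
rewrite /Rintegral integralE.
have [|r -> /andP[r0 rB]] := bound (fun x => (f x)%:E)^\+%E.
  move=> x Dx; rewrite funeposE -EFin_max !lee_fin le_max lexx orbT/= ge_max B0.
  by rewrite (le_trans (ler_norm _)) ?fB.
have [|t -> /andP[t0 tB]] := bound (fun x => (f x)%:E)^\-%E.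
  move=> x Dx; rewrite funenegE -EFinN -EFin_max !lee_fin le_max lexx orbT/=.
  by rewrite ge_max B0 andbT (le_trans (ler_norm _))// normrN fB.
rewrite -EFinB/= ler_norml; lra.
Qed.

End integral_complements.

(** * Densities and relative entropy *)

Section densities.
Local Open Scope charge_scope.
Context (R : realType) (d : nat) (M : set 'rV[R]_d) (mM : measurable M).
Local Notation leb := (@lebesgue_Rn R d).
Implicit Types (m : Prob M) (p f g : 'rV[R]_d -> R).

Lemma Prob_setC m : m (~` M) = 0%E.
Proof. by rewrite probability_setC// prob_supp subee. Qed.

Lemma Prob_setI m A : measurable A -> m A = m (A `&` M).
Proof.
move=> mA; apply/eqP; rewrite eq_le; apply/andP; split; last first.
  by apply: le_measure; rewrite ?inE//; exact: measurableI.
rewrite -[X in m X](setIT A) -(setUv M) setIUr (le_trans (measureU2 _ _ _))//.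
- exact: measurableI.
- by apply: measurableI => //; exact: measurableC.
rewrite -[leRHS]adde0 leeD2l// -(Prob_setC m) le_measure ?inE//.
- by apply: measurableI => //; exact: measurableC.
- exact: measurableC.
Qed.

Lemma density_int1 m p : is_density m p ->
  (\int[leb]_(x in M) (p x)%:E = 1)%E.
Proof. by move=> [_ _ pE]; rewrite -pE// prob_supp. Qed.

Lemma density_Rintegral1 m p : is_density m p -> \int[leb]_(x in M) p x = 1.
Proof. by move=> mp; rewrite /Rintegral (density_int1 mp). Qed.

Lemma density_integrable m p : is_density m p -> leb.-integrable M (EFin \o p).
Proof.
move=> mp; have [p1 p0 _] := mp; apply/integrableP.
split; first exact/measurable_EFinP.
rewrite (eq_integral (EFin \o p)) => [|x /set_mem Mx /=].
  by rewrite (density_int1 mp) ltry.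
by rewrite ger0_norm// p0.
Qed.

Lemma density_ac m p : is_density m p -> m `<< leb.
Proof.
move=> mp; have [p1 p0 pE] := mp; apply/null_content_dominatesP => A mA A0.
rewrite Prob_setI// pE; [|exact: measurableI|exact: subIsetr].
apply: null_set_integral.
- exact: measurableI.
- by apply/measurable_EFinP; apply: measurable_funS p1 => //; exact: subIsetr.
- apply/eqP; rewrite -measure_le0 -A0 le_measure ?inE//.
  by exact: measurableI.
Qed.

(** [KL] integrates Radon-Nikodym derivatives over the whole space; this lets explicit versions on M
    replace them. Both claims follow from uniqueness of a function with given integrals over all
    measurable sets. *)
Lemma density_ae m p : is_density m p ->
  ae_eq leb M (density m) p /\ ae_eq leb (~` M) (density m) (cst 0).
Proof.
move=> mp; have [p1 p0 pE] := mp; have mleb := density_ac mp.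
have H1 : ae_eq leb M ('d (charge_of_finite_measure m) '/d leb) (EFin \o p).
  apply: integral_ae_eq => //.
  - by apply: (integrableS measurableT) => //; exact: Radon_Nikodym_integrable.
  - exact/measurable_EFinP.
  - by move=> E EM mE; rewrite -Radon_Nikodym_integral// -pE.
have H2 : ae_eq leb (~` M) ('d (charge_of_finite_measure m) '/d leb) (cst 0%E).
  apply: integral_ae_eq => //.
  - exact: measurableC.
  - apply: (integrableS measurableT) => //; last exact: Radon_Nikodym_integrable.
    exact: measurableC.
  - move=> E EM mE; rewrite -Radon_Nikodym_integral// integral0.
    apply/eqP; rewrite -measure_le0 -(Prob_setC m) le_measure ?inE//.
    exact: measurableC.
split.
  by apply: filterS H1 => x + Mx; rewrite /density => ->.
by apply: filterS H2 => x + Mx; rewrite /density => ->.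
Qed.

Lemma Prob_integrable m f : measurable_fun M f -> bounded_on M f ->
  m.-integrable M (EFin \o f).
Proof.
move=> mf [K fK]; apply: measurable_bounded_integrable => //.
  by rewrite -ge0_fin_numE ?fin_num_measure.
exists K; split; first exact: num_real.
by move=> y Ky x Mx /=; rewrite (le_trans (fK _ Mx))// ltW.
Qed.

Lemma bounded_integrableM p f : measurable_fun M f -> bounded_on M f ->
  leb.-integrable M (EFin \o p) -> leb.-integrable M (EFin \o (fun x => f x * p x)).
Proof.
move=> mf [K fK] ip.
have mp : measurable_fun M p by apply/measurable_EFinP; exact: measurable_int ip.
apply: (@le_integrable _ _ _ _ _ mM _ (fun x => (K%:E * (p x)%:E)%E)).
- by apply/measurable_EFinP; exact: measurable_funM.
- move=> x Mx /=; rewrite lee_fin !normrM ler_wpM2r//.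
  by rewrite (le_trans (fK _ Mx)) ?ler_norm.
- exact: integrableZl.
Qed.

Lemma Rintegral_density m p f : is_density m p ->
  measurable_fun M f -> bounded_on M f ->
  \int[m]_(x in M) f x = \int[leb]_(x in M) (f x * p x).
Proof.
move=> mp mf bf; rewrite /Rintegral; congr fine.
have [H1 _] := density_ae mp; have [p1 p0 pE] := mp.
have mleb := density_ac mp.
rewrite -(Radon_Nikodym_change_of_variables mleb mM (Prob_integrable m mf bf)).
apply: ae_eq_integral => //.
- apply: emeasurable_funM; first exact/measurable_EFinP.
  by apply: measurable_funTS; apply: measurable_int; exact: Radon_Nikodym_integrable.
- by apply/measurable_EFinP; exact: measurable_funM.
- apply: filterS H1 => x + Mx => /(_ Mx) => <- /=.
  by rewrite EFinM /density fineK//; exact: Radon_Nikodym_fin_num.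
Qed.

Lemma Pac_density m : Pac m -> exists p, is_density m p.
Proof.
move=> mleb; pose g := Radon_Nikodym_SigmaFinite.f m leb.
have ig : leb.-integrable setT g by exact: Radon_Nikodym_SigmaFinite.f_integrable.
have gfin x : g x \is a fin_num by exact: Radon_Nikodym_SigmaFinite.f_fin_num.
exists (fine \o g); split.
- apply: measurable_funTS; apply: measurableT_comp; first exact: fine_measurable.
  exact: measurable_int ig.
- by move=> x _; rewrite fine_ge0// Radon_Nikodym_SigmaFinite.f_ge0.
- move=> A mA AM; rewrite (Radon_Nikodym_SigmaFinite.f_integral mleb)//.
  by apply: eq_integral => x _ /=; rewrite fineK.
Qed.

End densities.

Section real_integrable.
Context d (T : measurableType d) (R : realType).
Variables (mu : {measure set T -> \bar R}) (D : set T) (mD : measurable D).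
Implicit Types f g : T -> R.

Lemma integrable_scale c f : mu.-integrable D (EFin \o f) ->
  mu.-integrable D (EFin \o (fun x => c * f x)).
Proof. exact: integrableZl. Qed.

Lemma integrable_add f g :
  mu.-integrable D (EFin \o f) -> mu.-integrable D (EFin \o g) ->
  mu.-integrable D (EFin \o (fun x => f x + g x)).
Proof. exact: integrableD. Qed.

Lemma integrable_sub f g :
  mu.-integrable D (EFin \o f) -> mu.-integrable D (EFin \o g) ->
  mu.-integrable D (EFin \o (fun x => f x - g x)).
Proof. exact: integrableB. Qed.

End real_integrable.

Section measurable_inverse.
Context {R : realType}.

Lemma measurable_inv : measurable_fun [set: R] (@GRing.inv R).
Proof.
(* The inverse is built from exp and ln on each half-line; the value 0 at 0 agrees with the
   convention 0^-1 = 0. *)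
pose g x : R := if 0 < x then expR (- ln x) else 0.
have mg : measurable_fun [set: R] g.
  apply: measurable_fun_ifT => //.
  - exact: measurable_fun_ltr.
  - by apply: measurableT_comp => //; apply: measurableT_comp => //; exact: measurable_ln.
rewrite (_ : GRing.inv = (fun x => g x - g (- x))).
  apply: measurable_funB => //; exact: measurableT_comp.
apply/funext => x; rewrite /g oppr_gt0; case: ltgtP => x0.
- by rewrite subr0 expRN lnK ?posrE.
- by rewrite sub0r expRN lnK ?posrE ?oppr_gt0// invrN opprK.
- by rewrite -x0 invr0 subrr.
Qed.

Lemma measurable_funV d (T : measurableType d) (D : set T) (f : T -> R) :
  measurable_fun D f -> measurable_fun D (fun x => (f x)^-1).
Proof. by move=> mf; apply: measurableT_comp mf; exact: measurable_inv. Qed.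

Lemma measurable_ent d (T : measurableType d) (D : set T) (f g : T -> R) :
  measurable_fun D f -> measurable_fun D g ->
  measurable_fun D (fun x => ent (f x) (g x)).
Proof.
move=> mf mg; apply: measurable_funD => //; apply: measurable_funB => //.
apply: measurable_funM => //; apply: measurableT_comp; first exact: measurable_ln.
by apply: measurable_funM => //; exact: measurable_funV.
Qed.

End measurable_inverse.

Section relative_entropy.
Context (R : realType) (d : nat) (M : set 'rV[R]_d) (mM : measurable M).
Local Notation leb := (@lebesgue_Rn R d).
Implicit Types (m : Prob M) (p f g : 'rV[R]_d -> R).

(** A set null for m' has a vanishing integral of the positive function p', so it is Lebesgue null
    within M, and m has a density. *)
Lemma density_dominates m m' p p' : is_density m p -> is_density m' p' ->
  (forall x, M x -> 0 < p' x) -> m `<< m'.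
Proof.
move=> mp mp' p'0; apply/null_content_dominatesP => A mA A0.
have [p'1 _ p'E] := mp'.
have mAM : measurable (A `&` M) by exact: measurableI.
have AMM : A `&` M `<=` M by exact: subIsetr.
have int0 : (\int[leb]_(x in A `&` M) (p' x)%:E = 0)%E.
  rewrite -p'E//; apply/eqP; rewrite -measure_le0 -A0 le_measure ?inE//.
have lebAM : leb (A `&` M) = 0%E.
  have : ae_eq leb (A `&` M) (EFin \o p') (cst 0%E).
    apply/ae_eq_integral_abs => //.
      by apply/measurable_EFinP; apply: measurable_funS p'1.
    rewrite -[RHS]int0; apply: eq_integral => x /set_mem [_ Mx] /=.
    by rewrite ger0_norm// ltW// p'0.
  move=> [N [mN N0 sub]]; apply/eqP; rewrite -measure_le0 -N0 le_measure ?inE//.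
  move=> x AMx; apply: sub => /= /(_ AMx) /eqP; rewrite eqe.
  by rewrite gt_eqF// p'0//; case: AMx.
rewrite (Prob_setI mM)//.
have /null_content_dominatesP := density_ac mM mp.
exact.
Qed.

(** With a nonnegative integrand, finite and infinite entropies can be handled alike. The added
    terms integrate to 0, and off M the density of m vanishes almost everywhere. *)
Lemma KL_density m m' p p' : is_density m p -> is_density m' p' ->
  (forall x, M x -> 0 < p' x) ->
  KL m m' = (\int[leb]_(x in M) (ent (p x) (p' x))%:E)%E.
Proof.
move=> mp mp' p'0; rewrite /KL asboolT; last exact: density_dominates mp mp' p'0.
have [p1 p0 pE] := mp; have [p'1 _ p'E] := mp'.
have mdens (m1 : Prob M) p1' : is_density m1 p1' -> measurable_fun [set: 'rV[R]_d] (density m1).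
  move=> m1p; have mleb := density_ac mM m1p.
  rewrite /density; apply: measurableT_comp; first exact: fine_measurable.
  apply: measurable_int; exact: Radon_Nikodym_integrable.
pose h x := ln (p x / p' x) * p x.
have mh : measurable_fun M h.
  apply: measurable_funM => //; apply: measurableT_comp; first exact: measurable_ln.
  by apply: measurable_funM => //; exact: measurable_funV.
have [a1 b1] := density_ae mM mp; have [a2 b2] := density_ae mM mp'.
transitivity (\int[leb]_x ((EFin \o h) \_ M) x)%E.
  apply: ae_eq_integral => //.
  - apply/measurable_EFinP; apply: measurable_funM; last exact: mdens mp.
    apply: measurableT_comp; first exact: measurable_ln.
    apply: measurable_funM; first exact: mdens mp.
    by apply: measurable_funV; exact: mdens mp'.
  - by apply/(measurable_restrictT _ mM)/measurable_EFinP.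
  - apply: filterS3 a1 b1 a2 => x a1 b1 a2 _; rewrite /patch.
    case: ifPn => [/set_mem Mx|/negP Mx].
      by rewrite a1// a2.
    by rewrite b1 ?mulr0// => /mem_set.
rewrite -integral_mkcond.
have ip := density_integrable mM mp; have ip' := density_integrable mM mp'.
transitivity (\int[leb]_(x in M) (ent (p x) (p' x) + (p x - p' x))%:E)%E.
  by apply: eq_integral => x _ /=; congr EFin; rewrite /h /ent; ring.
rewrite ge0_integralD_integrable//.
- rewrite (_ : (\int[leb]_(x in M) (p x - p' x)%:E = 0)%E) ?adde0//.
  rewrite integralB_EFin//.
  by rewrite (density_int1 mM mp) (density_int1 mM mp') subee.
- exact: measurable_ent.
- by move=> x Mx; rewrite ent_ge0 ?p0 ?p'0.
- exact: integrable_sub.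
Qed.

Lemma KL_ge0 m m' p p' : is_density m p -> is_density m' p' ->
  (forall x, M x -> 0 < p' x) -> (0 <= KL m m')%E.
Proof.
move=> mp mp' p'0; rewrite (KL_density mp mp' p'0); apply: integral_ge0 => x Mx.
by have [_ p0 _] := mp; rewrite lee_fin ent_ge0 ?p0 ?p'0.
Qed.

Lemma KL_same m m' p : is_density m p -> is_density m' p ->
  (forall x, M x -> 0 < p x) -> KL m m' = 0%E.
Proof.
move=> mp mp' p0; rewrite (KL_density mp mp' p0) integral0_eq// => x Mx.
by rewrite ent_id// p0.
Qed.

Lemma density_Rintegral_indic m p A : is_density m p -> measurable A ->
  fine (m A) = \int[leb]_(x in M) (\1_A x * p x).
Proof.
move=> mp mA; have [p1 p0 pE] := mp.
rewrite (Prob_setI mM)// pE; [|exact: measurableI|exact: subIsetr].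
rewrite /Rintegral setIC integral_mkcondr; congr fine; apply: eq_integral => x _.
by rewrite /patch indicE; case: ifP => _; rewrite ?mul1r ?mul0r.
Qed.

(* Pinsker's inequality: in the variational bound KL >= s m(A) - ln (int e^(s 1_A) dm'),
   Hoeffding's lemma bounds the logarithm and s = 4 (m(A) - m'(A)) is optimal. *)
Lemma pinsker_set m m' p p' A : is_density m p -> is_density m' p' ->
  (forall x, M x -> 0 < p' x) -> measurable A -> fine (m' A) <= fine (m A) ->
  ((2 * (fine (m A) - fine (m' A)) ^+ 2)%:E <= KL m m')%E.
Proof.
move=> mp mp' p'0 mA QP; set P := fine (m A); set Q := fine (m' A).
have [p1 p0 pE] := mp; have [p'1 _ p'E] := mp'.
have Q0 : 0 <= Q by rewrite fine_ge0.
have Q1 : Q <= 1 by rewrite -lee_fin fineK ?fin_num_measure// probability_le1.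
pose s := 4 * (P - Q); have s0 : 0 <= s by rewrite mulr_ge0// subr_ge0.
pose c := Q * s + s ^+ 2 / 8.
pose f x := s * \1_A x - c.
have fE x : expR (f x) = (1 + (expR s - 1) * \1_A x) * expR (- c).
  rewrite /f expRD indicE; case: (x \in A); rewrite /= ?(mulr0, mulr1, expR0, addr0, subrKC)//.
(* The optimal s = 4 (P - Q) turns s (P - Q) - s^2 / 8 into 2 (P - Q)^2. *)
have -> : 2 * (P - Q) ^+ 2 = s * P - c by rewrite /c /s; field.
have ip := density_integrable mM mp; have ip' := density_integrable mM mp'.
have m1A : measurable_fun M (\1_A : _ -> R) by exact: measurable_indic.
have b1A : bounded_on M (\1_A : _ -> R).
  by exists 1 => x _; rewrite indicE; case: (x \in A); rewrite ?normr1 ?normr0.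
have i1 := bounded_integrableM mM m1A b1A ip.
have i2 := bounded_integrableM mM m1A b1A ip'.
pose k x := p x * f x - p' x * expR (f x) + p' x.
pose a1 x := s * (\1_A x * p x); pose a2 x := - c * p x.
pose a3 x := (1 - expR (- c)) * p' x.
pose a4 x := - ((expR s - 1) * expR (- c)) * (\1_A x * p' x).
have kE x : k x = a1 x + a2 x + a3 x + a4 x.
  by rewrite /k fE /f /a1 /a2 /a3 /a4; ring.
have I1 : leb.-integrable M (EFin \o a1) by exact: integrable_scale.
have I2 : leb.-integrable M (EFin \o a2) by exact: integrable_scale.
have I3 : leb.-integrable M (EFin \o a3) by exact: integrable_scale.
have I4 : leb.-integrable M (EFin \o a4) by exact: integrable_scale.
have Ik : leb.-integrable M (EFin \o k).
  rewrite (_ : k = fun x => a1 x + a2 x + a3 x + a4 x); last exact/funext.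
  by do 3 (apply: integrable_add => //).
have intk : \int[leb]_(x in M) k x =
    s * P - c + (1 - expR (- c)) - (expR s - 1) * expR (- c) * Q.
  under eq_Rintegral do rewrite kE.
  rewrite !RintegralD//; last 2 first.
  - exact: integrable_add.
  - by apply: integrable_add => //; exact: integrable_add.
  rewrite !RintegralZl// (density_Rintegral1 mM mp) (density_Rintegral1 mM mp').
  by rewrite -(density_Rintegral_indic mp mA) -(density_Rintegral_indic mp' mA) -/P -/Q; ring.
have hoef := hoeffding_bernoulli Q0 Q1 s0.
(* The left side is the integral of exp f against m'; Hoeffding's bound makes it at most 1, so the
   integral of k is at least s P - c. *)
have Dle : (1 - Q + Q * expR s) * expR (- c) <= 1.
  by rewrite expRN -/c ler_pdivrMr ?expR_gt0// mul1r.
apply: (@le_trans _ _ (\int[leb]_(x in M) k x)%:E).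
  by rewrite intk lee_fin; lra.
rewrite /Rintegral fineK; last exact: integrable_fin_num.
rewrite (KL_density mp mp' p'0).
have kent x : M x -> k x <= ent (p x) (p' x).
  by move=> Mx; rewrite ent_young ?p0 ?p'0.
have -> : (\int[leb]_(x in M) (ent (p x) (p' x))%:E =
  \int[leb]_(x in M) ((ent (p x) (p' x) - k x) + k x)%:E)%E.
  by apply: eq_integral => x _; rewrite subrK.
rewrite (@ge0_integralD_integrable _ _ _ leb M (fun x => ent (p x) (p' x) - k x) k)//.
- rewrite -[leLHS]add0e leeD2r//; apply: integral_ge0 => x Mx.
  by rewrite lee_fin subr_ge0 kent.
- apply: measurable_funB; first exact: measurable_ent.
  by apply/measurable_EFinP; exact: measurable_int Ik.
- by move=> x Mx; rewrite subr_ge0 kent.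
Qed.

(** Passing to the complement of A reverses the sign of m(A) - m'(A). *)
Lemma pinsker_abs m m' p p' A : is_density m p -> is_density m' p' ->
  (forall x, M x -> 0 < p' x) -> measurable A ->
  ((2 * (fine (m A) - fine (m' A)) ^+ 2)%:E <= KL m m')%E.
Proof.
move=> mp mp' p'0 mA.
have [QP|PQ] := leP (fine (m' A)) (fine (m A)); first exact: (pinsker_set mp mp').
have C (m1 : Prob M) : fine (m1 (~` A)) = 1 - fine (m1 A).
  by rewrite probability_setC// fineB// fin_num_measure.
have := @pinsker_set m m' p p' (~` A) mp mp' p'0 (measurableC mA).
rewrite !C (_ : _ - (1 - fine (m' A)) = - (fine (m A) - fine (m' A))).
  by rewrite sqrrN; apply; lra.
ring.
Qed.

Lemma pinsker m m' p p' : is_density m p -> is_density m' p' ->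
  (forall x, M x -> 0 < p' x) ->
  ((TV m m' ^+ 2)%:E <= (2^-1)%:E * KL m m')%E.
Proof.
move=> mp mp' p'0; have := KL_ge0 mp mp' p'0.
have pin := fun A mA => @pinsker_abs m m' p p' A mp mp' p'0 mA.
move: pin; case: (KL m m') => [k| |]//= pin; last first.
  by move=> _; rewrite mulry gtr0_sg ?invr_gt0// mul1e leey.
rewrite lee_fin => k0; rewrite -EFinM lee_fin.
have bnd A : measurable A -> `|fine (m A) - fine (m' A)| <= Num.sqrt (k / 2).
  move=> mA; rewrite -sqrtr_sqr ler_wsqrtr//.
  by have := pin A mA; rewrite lee_fin; lra.
have TVle : TV m m' <= Num.sqrt (k / 2).
  apply: ge_sup; last by move=> _ [A mA <-]; exact: bnd.
  by exists `|fine (m set0) - fine (m' set0)|; exists set0 => //; exact: measurable0.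
have TV0 : 0 <= TV m m'.
  apply: ub_le_sup; last by exists set0; [exact: measurable0|rewrite !measure0 subrr normr0].
  by exists (Num.sqrt (k / 2)) => _ [A mA <-]; exact: bnd.
rewrite mulrC -(@sqr_sqrtr _ (k / 2)) ?divr_ge0// ler_sqr ?nnegrE//.
Qed.

End relative_entropy.

(** * Mixtures of measures and convexity of the entropy *)

Section entropy_mixture.
Context (R : realType) (d : nat) (M : set 'rV[R]_d) (mM : measurable M).
Local Notation leb := (@lebesgue_Rn R d).
Implicit Types (m mq : Prob M) (p f g n q : 'rV[R]_d -> R).

(** Solve n' = (1 - l) n + l r for r: the hypothesis says that r is within relative distance [eta]
    of q, and [eta <= 1] keeps r nonnegative. Convexity then splits the entropy, and the r-part
    costs only eta^2 by [ent_close]. *)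
Lemma KL_mixture m m' mq n n' q l eta :
  is_density m n -> is_density m' n' -> is_density mq q ->
  (forall x, M x -> 0 < q x) -> 0 < l -> l < 1 -> eta <= 1 ->
  (forall x, M x -> `|n' x - (1 - l) * n x - l * q x| <= l * eta * q x) ->
  (KL m' mq <= (1 - l)%:E * KL m mq + (l * eta ^+ 2)%:E)%E.
Proof.
move=> mn mn' mqq q0 l0 l1 eta1 close.
have [n1 n0 _] := mn; have [n'1 _ _] := mn'; have [q1 _ _] := mqq.
have l1' : 0 < 1 - l by rewrite subr_gt0.
rewrite (KL_density mM mn mqq q0) (KL_density mM mn' mqq q0).
have pt x : M x -> ent (n' x) (q x) <= (1 - l) * ent (n x) (q x) + l * eta ^+ 2 * q x.
  move=> Mx; pose r := l^-1 * (n' x - (1 - l) * n x).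
  have n'E : n' x = (1 - l) * n x + l * r.
    by rewrite /r mulrA divff ?gt_eqF// mul1r subrKC.
  have rq : `|r - q x| <= eta * q x.
    rewrite -(ler_pM2l l0) -{1}(gtr0_norm l0) -normrM mulrA (le_trans _ (close _ Mx))//.
    by rewrite n'E [X in `|X - _ * _|]addrAC subrr add0r -mulrBr.
  have r0 : 0 <= r.
    have := q0 _ Mx; move: rq; rewrite ler_norml => /andP[+ _] qx.
    have : eta * q x <= q x by rewrite ler_piMl// ltW.
    by lra.
  rewrite n'E (le_trans (ent_convex (n0 _ Mx) r0 (q0 _ Mx) l0 l1))// lerD2l -mulrA.
  by rewrite ler_pM2l// ent_close// q0.
have ment : measurable_fun M (fun x => ent (n x) (q x)) by exact: measurable_ent.
have ent0 x : M x -> 0 <= ent (n x) (q x) by move=> Mx; rewrite ent_ge0 ?n0 ?q0.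
have le0 : 0 <= l * eta ^+ 2 by rewrite mulr_ge0 ?sqr_ge0// ltW.
have iq := density_integrable mM mqq.
apply: (@le_trans _ _ (\int[leb]_(x in M)
    ((1 - l) * ent (n x) (q x) + l * eta ^+ 2 * q x)%:E)%E).
  apply: ge0_le_integral_nonmeasurable => x Mx; rewrite lee_fin ?pt// ent_ge0 ?q0//.
  by have [_ + _] := mn'; exact.
rewrite ge0_integralD_integrable//.
- under eq_integral do rewrite EFinM.
  rewrite ge0_integralZl//; last 2 first.
  + by apply/measurable_EFinP.
  + by rewrite lee_fin ltW.
  apply: leeD2l.
  under eq_integral do rewrite EFinM.
  by rewrite integralZl// (density_int1 mM mqq) mule1.
- exact: measurable_funM.
- by move=> x Mx; rewrite mulr_ge0 ?ent0// ltW.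
- exact: integrable_scale.
Qed.

Lemma mix_density e m m' p p' : 0 <= e -> e <= 1 ->
  is_density m p -> is_density m' p' ->
  is_density (mix e m m') (fun x => (1 - e) * p x + e * p' x).
Proof.
move=> e0 e1 mp mp'; have [p1 p0 pE] := mp; have [p'1 p'0 p'E] := mp'.
(* For e in [0, 1] the truncation in [weight] is the identity. *)
have wE : weight e = e.
  by rewrite /weight (max_idPr _)// (min_idPr _).
have e1' : 0 <= 1 - e by rewrite subr_ge0.
split.
- by apply: measurable_funD; exact: measurable_funM.
- by move=> x Mx; rewrite addr_ge0// mulr_ge0 ?p0 ?p'0.
- move=> A mA AM; rewrite [LHS]mix_measureE wE pE// p'E//.
  have mpA : measurable_fun A p by exact: measurable_funS p1.
  have mp'A : measurable_fun A p' by exact: measurable_funS p'1.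
  have pA x : A x -> (0 <= (p x)%:E)%E by move=> /AM Mx; rewrite lee_fin p0.
  have p'A x : A x -> (0 <= (p' x)%:E)%E by move=> /AM Mx; rewrite lee_fin p'0.
  rewrite -!ge0_integralZl//; try by apply/measurable_EFinP.
  rewrite -ge0_integralD//.
  + by move=> x Ax; rewrite mule_ge0 ?pA.
  + by apply/measurable_EFinP; exact: measurable_funM.
  + by move=> x Ax; rewrite mule_ge0 ?p'A.
  + by apply/measurable_EFinP; exact: measurable_funM.
Qed.

(** Provides the dominating function required by the Lipschitz estimates below: the density moves by
    e (p' - p). *)
Lemma mix_density_close e m m' p p' (s := fun x => e * (p' x + p x)) : 0 < e ->
  is_density m p -> is_density m' p' ->
  [/\ leb.-integrable M (EFin \o s),
      \int[leb]_(x in M) s x = 2 * e &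
      forall x, M x -> `|(1 - e) * p x + e * p' x - p x| <= s x].
Proof.
move=> e0 mp mp'; have [_ p0 _] := mp; have [_ p'0 _] := mp'.
have ip := density_integrable mM mp; have ip' := density_integrable mM mp'.
split.
- by apply: integrable_scale => //; exact: integrable_add.
- rewrite RintegralZl//; last exact: integrable_add.
  by rewrite RintegralD// (density_Rintegral1 mM mp) (density_Rintegral1 mM mp') mulrC.
- move=> x Mx; rewrite /s (_ : _ - p x = e * (p' x - p x)); last by ring.
  rewrite normrM (gtr0_norm e0) ler_pM2l// ler_norml.
  by have := p0 x Mx; have := p'0 x Mx; move: (p x) (p' x) => u v; lra.
Qed.

(** Joint continuity is relative to M in the second variable. Slicing at fixed m shows that
    preimages of open intervals are traces on M of open sets. *)
Lemma flat_derivative_measurable (G : Prob M -> R) D m :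
  is_flat_derivative G D -> measurable_fun M (D m).
Proof.
move=> [cD _ _ _].
apply: (measurability _ (@RGenOpens.measurableE R)).
move=> _ [_ [a [b ->] <-]].
have oab : open (`]a, b[%classic : set R) by exact: interval_open.
have /continuousP/(_ _ oab)/open_subspaceP[V oV VE] := cD.
have -> : M `&` D m @^-1` `]a, b[ = M `&` (fun x => (m, x)) @^-1` V.
  apply/seteqP; split => x [Mx Dx]; split => //.
    have : (V `&` [set: Prob M] `*` M) (m, x) by rewrite VE.
    by case.
  have : (V `&` [set: Prob M] `*` M) (m, x) by [].
  by rewrite VE => -[].
apply: measurableI => //; apply: sub_sigma_algebra.
have /continuousP : continuous (fun x : 'rV[R]_d => (m, x)).
  move=> x; apply: (@cvg_pair _ _ _ _ (nbhs m) (nbhs x) (nbhs_filter x)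
    (nbhs_filter m) (nbhs_filter x)); last exact: cvg_id.
  by move=> A Am; apply: (@filterE _ _ (nbhs_filter x)) => y; exact: nbhs_singleton Am.
exact.
Qed.

End entropy_mixture.

(** * Flat derivatives *)

Section flat_derivative_lipschitz.
Context (R : realType) (d : nat) (M : set 'rV[R]_d) (mM : measurable M).
Local Notation leb := (@lebesgue_Rn R d).
Implicit Types (m : Prob M) (p f s : 'rV[R]_d -> R) (C : R).

Lemma Rintegral_density_diff_le m m' p p' s f C : is_density m p -> is_density m' p' ->
  leb.-integrable M (EFin \o s) -> (forall x, M x -> `|p' x - p x| <= s x) ->
  measurable_fun M f -> (forall x, M x -> `|f x| <= C) ->
  `|\int[m']_(x in M) f x - \int[m]_(x in M) f x| <= C * \int[leb]_(x in M) s x.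
Proof.
move=> mp mp' si sle mf fC; have bf : bounded_on M f by exists C.
have ip := density_integrable mM mp; have ip' := density_integrable mM mp'.
rewrite (Rintegral_density mM mp)// (Rintegral_density mM mp')//.
have i1 := bounded_integrableM mM mf bf ip.
have i2 := bounded_integrableM mM mf bf ip'.
rewrite -RintegralB// -RintegralZl//.
have i12 := integrable_sub mM i2 i1.
apply: le_trans (le_normr_Rintegral mM i12) _.
apply: le_Rintegral => //.
- exact: integrable_norm.
- exact: integrable_scale.
- move=> x Mx; rewrite -mulrBr normrM ler_pM//; [exact: fC|exact: sle].
Qed.

(** The signed measure m' - m in the integral formula does not depend on the mixing parameter, so
    one estimate serves all of [0, 1]. A dominating function [s] appears because the flow is
    controlled pointwise in x. *)
Lemma flat_derivative_lipschitz (G : Prob M -> R) D m m' p p' s C :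
  is_density m p -> is_density m' p' ->
  leb.-integrable M (EFin \o s) -> (forall x, M x -> `|p' x - p x| <= s x) ->
  is_flat_derivative G D -> (forall m x, M x -> `|D m x| <= C) ->
  `|G m' - G m| <= C * \int[leb]_(x in M) s x.
Proof.
move=> mp mp' si sle GD DC; have [_ _ GE _] := GD.
have L01 : lebesgue_measure (`[0, 1]%classic : set R) = 1%E.
  by rewrite lebesgue_measure_itv/= lte01 oppr0 adde0.
rewrite GE; set B := C * _.
rewrite [leRHS](_ : B = B * fine (lebesgue_measure (`[0, 1]%classic : set R))); last first.
  by rewrite L01 mulr1.
apply: normr_Rintegral_le_nonmeasurable => //.
  by apply: le_lt_trans (ltry 1); rewrite le_eqVlt; apply/orP; left; apply/eqP; exact: L01.
move=> e _; apply: (Rintegral_density_diff_le mp mp') => //.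
- exact: flat_derivative_measurable GD.
- by move=> x; exact: DC.
Qed.

End flat_derivative_lipschitz.

(** * Gibbs measures *)

Section gibbs.
Context (R : realType) (d : nat) (M : set 'rV[R]_d) (mM : measurable M).
Local Notation leb := (@lebesgue_Rn R d).
Implicit Types (m : Prob M) (n f g : 'rV[R]_d -> R) (K delta : R).
Variable U : 'rV[R]_d -> R.
Hypothesis mU : measurable_fun M U.
Hypothesis U1 : (\int[leb]_(x in M) (expR (- U x))%:E = 1)%E.

Definition tilt g (x : 'rV[R]_d) : R := - g x - U x.
Definition partition_function g : R := \int[leb]_(x in M) expR (tilt g x).
Local Notation Z := partition_function.
Local Notation w := (fun x => expR (- U x)).

Lemma tiltE g x : expR (tilt g x) = expR (- g x) * expR (- U x).
Proof. by rewrite /tilt expRD. Qed.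

Let mw : measurable_fun M w.
Proof. by apply: measurableT_comp => //; exact: measurableT_comp. Qed.

Lemma reference_integrable : leb.-integrable M (EFin \o w).
Proof.
apply/integrableP; split; first exact/measurable_EFinP.
rewrite (eq_integral (EFin \o w)) => [|x _ /=]; first by rewrite [ltLHS]U1 ltry.
by rewrite ger0_norm// expR_ge0.
Qed.

Let Rint_w : \int[leb]_(x in M) w x = 1.
Proof. by rewrite /Rintegral U1. Qed.

Lemma expRN_bounded g : bounded_on M g -> bounded_on M (fun x => expR (- g x)).
Proof.
move=> [K gK]; exists (expR K) => x Mx; rewrite ger0_norm ?expR_ge0// ler_expR.
by rewrite (le_trans _ (gK _ Mx))// -normrN ler_norm.
Qed.

Lemma tilt_measurable g : measurable_fun M g -> measurable_fun M (tilt g).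
Proof. by move=> mg; apply: measurable_funB => //; exact: measurableT_comp. Qed.

Lemma tilt_integrable g : measurable_fun M g -> bounded_on M g ->
  leb.-integrable M (EFin \o (fun x => expR (tilt g x))).
Proof.
move=> mg bg; rewrite (_ : (fun x => _) = fun x => expR (- g x) * expR (- U x)).
  apply: bounded_integrableM => //.
  - by apply: measurableT_comp => //; exact: measurableT_comp.
  - exact: expRN_bounded.
  - exact: reference_integrable.
by apply/funext => x; rewrite tiltE.
Qed.

Lemma partition_function_le g g' delta :
  measurable_fun M g -> bounded_on M g -> measurable_fun M g' -> bounded_on M g' ->
  (forall x, M x -> `|g' x - g x| <= delta) -> Z g' <= expR delta * Z g.
Proof.
move=> mg bg mg' bg' gg'; rewrite /Z -RintegralZl//; last exact: tilt_integrable.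
apply: le_Rintegral => //.
- exact: tilt_integrable.
- by apply: integrable_scale => //; exact: tilt_integrable.
- move=> x Mx; rewrite -expRD ler_expR /tilt addrA lerD2r.
  by have := gg' _ Mx; rewrite ler_norml; lra.
Qed.

Lemma partition_function0 : Z (cst 0) = 1.
Proof.
rewrite -Rint_w /Z; congr Rintegral.
by apply/funext => x; rewrite /tilt oppr0 add0r.
Qed.

Let b0 : bounded_on M (cst 0 : 'rV[R]_d -> R).
Proof. by exists 0 => x _; rewrite normr0. Qed.

(** Compare with the zero potential, whose partition function is 1. *)
Lemma partition_function_bounds g K : measurable_fun M g ->
  (forall x, M x -> `|g x| <= K) -> expR (- K) <= Z g <= expR K.
Proof.
move=> mg gK; have bg : bounded_on M g by exists K.
have := @partition_function_le (cst 0) g K (measurable_cst _) b0 mg bg.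
rewrite partition_function0 mulr1 => ->; last by move=> x Mx; rewrite subr0 gK.
have := @partition_function_le g (cst 0) K mg bg (measurable_cst _) b0.
rewrite partition_function0 andbT expRN -ler_pdivrMl ?expR_gt0// mulr1; apply.
by move=> x Mx; rewrite sub0r normrN gK.
Qed.

Lemma partition_function_gt0 g : measurable_fun M g -> bounded_on M g -> 0 < Z g.
Proof.
move=> mg [K gK]; have /andP[+ _] := partition_function_bounds mg gK.
exact/lt_le_trans/expR_gt0.
Qed.

Local Notation q g := (gibbs_density M (tilt g)).

Lemma gibbs_is_density (m0 : Prob M) g : measurable_fun M g -> bounded_on M g ->
  is_density (gibbs m0 (tilt g)) (q g).
Proof.
move=> mg bg; have Z0 := partition_function_gt0 mg bg.
have ig := tilt_integrable mg bg; have ifin := integrable_fin_num mM ig.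
apply: gibbsP => //; first exact: tilt_measurable.
- by rewrite ltey_eq ifin.
- by rewrite -(fineK ifin) lte_fin.
Qed.

Lemma gibbs_density_gt0 g x : measurable_fun M g -> bounded_on M g -> 0 < q g x.
Proof. by move=> mg bg; rewrite divr_gt0 ?expR_gt0// partition_function_gt0. Qed.

Lemma gibbs_densityE g x : measurable_fun M g -> bounded_on M g ->
  q g x = expR (- U x) * expR (- (g x + ln (Z g))).
Proof.
move=> mg bg; rewrite /gibbs_density -/(Z g) tiltE opprD expRD.
rewrite (expRN (ln _)) lnK ?posrE ?partition_function_gt0//.
by rewrite mulrA [_ * expR (- g x)]mulrC.
Qed.

Lemma gibbs_density_le g K x : measurable_fun M g ->
  (forall x, M x -> `|g x| <= K) -> M x -> q g x <= expR (2 * K) * expR (- U x).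
Proof.
move=> mg gK Mx; have bg : bounded_on M g by exists K.
have Z0 := partition_function_gt0 mg bg.
rewrite gibbs_densityE// mulrC ler_pM2r ?expR_gt0// ler_expR.
have /andP[+ _] := partition_function_bounds mg gK.
rewrite -{1}[Z g]lnK ?posrE// ler_expR.
by have := gK _ Mx; rewrite ler_norml; lra.
Qed.

(** The potential and the logarithm of Z each change by at most [delta], so the ratio of the
    densities is exp u with |u| <= 2 delta; linearizing exp doubles this once more. *)
Lemma gibbs_density_close g g' delta x :
  measurable_fun M g -> bounded_on M g -> measurable_fun M g' -> bounded_on M g' ->
  (forall x, M x -> `|g' x - g x| <= delta) -> delta <= 4^-1 -> M x ->
  `|q g' x - q g x| <= 4 * delta * q g x.
Proof.
move=> mg bg mg' bg' gg' d4 Mx.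
have Z0 := partition_function_gt0 mg bg; have Z0' := partition_function_gt0 mg' bg'.
have lnZ : `|ln (Z g') - ln (Z g)| <= delta.
  rewrite ler_norml lerBlDl lerBrDl.
  have gg x' : M x' -> `|g x' - g' x'| <= delta by rewrite distrC; exact: gg'.
  have := partition_function_le mg bg mg' bg' gg'.
  have := partition_function_le mg' bg' mg bg gg.
  rewrite -{1}[Z g]lnK ?posrE// -{1}[Z g']lnK ?posrE// -expRD ler_expR => H.
  rewrite -{1}[Z g]lnK ?posrE// -{1}[Z g']lnK ?posrE// -expRD ler_expR => H'.
  by move: (ln _) (ln _) H H' => a b H H'; lra.
have q0 := gibbs_density_gt0 x mg bg.
pose u := - ((g' x - g x) + (ln (Z g') - ln (Z g))).
have qE : q g' x = expR u * q g x.
  rewrite !gibbs_densityE// [RHS]mulrCA -[in RHS]expRD; congr (_ * expR _).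
  by rewrite /u; move: (ln _) (ln _) => a b; ring.
rewrite qE -{2}[q g x]mul1r -mulrBl normrM (gtr0_norm q0) ler_pM2r//.
have -> : 4 * delta = 2 * (2 * delta) by ring.
apply: expR_sub1_le; last by lra.
rewrite /u normrN (le_trans (ler_normD _ _))// mulrDl mul1r lerD//.
exact: gg'.
Qed.

(** The two integrands differ by n (g + ln Z) plus a difference of two probability densities. This
    is integrable because g is bounded, so the identity also covers infinite entropies. *)
Lemma KL_tilt (m mpi m0 : Prob M) n g : is_density mpi w -> is_density m n ->
  measurable_fun M g -> bounded_on M g ->
  KL m (gibbs m0 (tilt g)) =
  (KL m mpi + (\int[m]_(x in M) g x + ln (Z g))%:E)%E.
Proof.
move=> mpiw mn mg bg.
have Mq := gibbs_is_density m0 mg bg.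
have w0 (x : 'rV[R]_d) : M x -> 0 < expR (- U x) by move=> _; exact: expR_gt0.
have q0 x : M x -> 0 < q g x by move=> _; exact: gibbs_density_gt0.
rewrite (KL_density mM mn Mq q0) (KL_density mM mn mpiw w0).
have [n1 n0 _] := mn; have ni := density_integrable mM mn.
pose k x := n x * (g x + ln (Z g)) + (q g x - w x).
have i1 := bounded_integrableM mM mg bg ni.
have i2 : leb.-integrable M (EFin \o (fun x => ln (Z g) * n x)).
  exact: integrable_scale.
have iq := density_integrable mM Mq.
have i3 := integrable_sub mM iq reference_integrable.
have kE : k = fun x => g x * n x + ln (Z g) * n x + (q g x - w x).
  by apply/funext => x; rewrite /k; ring.
have ik : leb.-integrable M (EFin \o k).
  by rewrite kE; apply: integrable_add => //; exact: integrable_add.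
have intk : \int[leb]_(x in M) k x = \int[m]_(x in M) g x + ln (Z g).
  have e1 := RintegralD mM i1 i2.
  have e2 := RintegralB mM iq reference_integrable.
  have e3 := RintegralD mM (integrable_add mM i1 i2) i3.
  have e4 := RintegralZl (ln (Z g)) mM ni.
  rewrite kE e3 e1 e2 e4 (Rintegral_density mM mn)// Rint_w.
  by rewrite (density_Rintegral1 mM mn) (density_Rintegral1 mM Mq); ring.
rewrite -intk /Rintegral fineK; last exact: integrable_fin_num.
rewrite -(@ge0_integralD_integrable _ _ _ leb M (fun x => ent (n x) (w x)) k)//.
- apply: eq_integral => x /set_mem Mx; congr EFin; rewrite /k addrA.
  by apply: ent_change; [exact: n0|exact: expR_gt0|exact: gibbs_densityE].
- exact: measurable_ent.
- by move=> x Mx; rewrite ent_ge0 ?n0 ?expR_gt0.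
Qed.

End gibbs.

Section ereal_shift.
Context {R : realType}.
Local Open Scope ereal_scope.

Lemma ereal_shift_le (E : \bar R) (a b : R) :
  E + a%:E = 0 -> 0 <= E + b%:E -> (a <= b)%R.
Proof.
case: E => [r| |]//=; rewrite -!EFinD lee_fin => /(congr1 fine)/= H H'; lra.
Qed.

Lemma leD_shift (E : \bar R) (a b c : R) : (a <= b + c)%R ->
  E + a%:E <= E + b%:E + c%:E.
Proof. by move=> abc; rewrite -addeA -EFinD leeD2l// lee_fin. Qed.

Lemma leM_shift (E K : \bar R) (c a b e : R) : (0 < c)%R -> E <= K + a%:E ->
  (c * a + b <= e)%R -> c%:E * E + b%:E <= c%:E * K + e%:E.
Proof.
move=> c0 EK abe; apply: (@le_trans _ _ (c%:E * (K + a%:E) + b%:E)).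
  by rewrite leeD2r// lee_pmul2l.
by rewrite muleDr// ?fin_num_adde_defl// -addeA -EFinM -EFinD leeD2l// lee_fin.
Qed.

End ereal_shift.

(** * One player *)

Section best_response.
Local Opaque gibbs KL gibbs_density partition_function tilt.
Context (R : realType) (d : nat) (M : set 'rV[R]_d) (mM : measurable M).
Local Notation leb := (@lebesgue_Rn R d).
Implicit Types (m mz : Prob M) (n f g : 'rV[R]_d -> R) (K delta eta l : R).
Variables (U : 'rV[R]_d -> R) (mpi : Prob M).
Hypothesis mU : measurable_fun M U.
Hypothesis U1 : (\int[leb]_(x in M) (expR (- U x))%:E = 1)%E.
Hypothesis mpiw : is_density mpi (fun x => expR (- U x)).
Local Notation Z := (partition_function M U).
Local Notation tilt := (tilt U).
Local Notation q g := (gibbs_density M (tilt g)).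

(** Evaluate [KL_tilt] at the Gibbs measure of g': its entropy relative to itself is 0 and relative
    to the Gibbs measure of g is nonnegative. The common entropy relative to [mpi] is finite by the
    first relation and cancels. *)
Lemma ln_partition_function_le mz g g' :
  measurable_fun M g -> bounded_on M g -> measurable_fun M g' -> bounded_on M g' ->
  ln (Z g') - ln (Z g) <=
    - (\int[gibbs mz (tilt g')]_(x in M) g' x - \int[gibbs mz (tilt g')]_(x in M) g x).
Proof.
move=> mg bg mg' bg'.
have Mq := gibbs_is_density mM mU U1 mz mg bg.
have Mq' := gibbs_is_density mM mU U1 mz mg' bg'.
have q0 x : M x -> 0 < q g x by move=> _; exact: gibbs_density_gt0.
have q0' x : M x -> 0 < q g' x by move=> _; exact: gibbs_density_gt0.
have := KL_ge0 mM Mq' Mq q0; rewrite (KL_tilt mM mU U1 mz mpiw Mq' mg bg).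
have := KL_same mM Mq' Mq' q0'; rewrite (KL_tilt mM mU U1 mz mpiw Mq' mg' bg').
move=> H H'; have := ereal_shift_le H H'.
by move: (Rintegral _ _ _) (Rintegral _ _ _) (ln _) (ln _) => A B a b; lra.
Qed.

Lemma KL_gibbs_change m mz mz' n g g' :
  measurable_fun M g -> bounded_on M g -> measurable_fun M g' -> bounded_on M g' ->
  is_density m n ->
  (KL m (gibbs mz' (tilt g')) <= KL m (gibbs mz (tilt g)) +
    ((\int[m]_(x in M) g' x - \int[m]_(x in M) g x) -
     (\int[gibbs mz' (tilt g')]_(x in M) g' x -
      \int[gibbs mz' (tilt g')]_(x in M) g x))%:E)%E.
Proof.
move=> mg bg mg' bg' mn; have H := ln_partition_function_le mz' mg bg mg' bg'.
have E1 := KL_tilt mM mU U1 mz mpiw mn mg bg.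
have E2 := KL_tilt mM mU U1 mz' mpiw mn mg' bg'.
apply: (@le_trans _ _ (KL m mpi + (\int[m]_(x in M) g' x + ln (Z g'))%:E)%E).
  by rewrite le_eqVlt E2 eqxx.
rewrite E1; apply: leD_shift; move: H.
move: (Rintegral m _ _) (Rintegral m _ _) (Rintegral _ _ _) (Rintegral _ _ _).
by move: (ln _) (ln _) => a b A B C D; lra.
Qed.

(* The correction is (1 - l) / l times a difference of pairings with g' - g, which has a
   sign once both players are added, up to terms of second order in the step size. *)
Lemma KL_gibbs_step m m' mz mz' n n' g g' l eta delta :
  measurable_fun M g -> bounded_on M g -> measurable_fun M g' -> bounded_on M g' ->
  is_density m n -> is_density m' n' ->
  0 < l -> l < 1 -> 0 <= eta -> eta <= 1 ->
  (forall x, M x -> `|g' x - g x| <= delta) ->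
  (forall x, M x -> `|n' x - (1 - l) * n x - l * q g' x| <= l * eta * q g' x) ->
  (KL m' (gibbs mz' (tilt g')) <= (1 - l)%:E * KL m (gibbs mz (tilt g)) +
    ((1 - l) / l * ((\int[m]_(x in M) g' x - \int[m]_(x in M) g x) -
                    (\int[m']_(x in M) g' x - \int[m']_(x in M) g x))
     + delta * eta + l * eta ^+ 2)%:E)%E.
Proof.
move=> mg bg mg' bg' mn mn' l0 l1 eta0 eta1 gg' close.
have Mq' := gibbs_is_density mM mU U1 mz' mg' bg'.
have q0' x : M x -> 0 < q g' x by move=> _; exact: gibbs_density_gt0.
have l1' : 0 < 1 - l by rewrite subr_gt0.
apply: le_trans (KL_mixture mM mn mn' Mq' q0' l0 l1 eta1 close) _.
have chg := KL_gibbs_change mz mz' mg bg mg' bg' mn.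
apply: (leM_shift l1' chg); rewrite lerD2r => {chg}.
pose D x := g' x - g x.
have mD : measurable_fun M D by exact: measurable_funB.
have bD : bounded_on M D by exists delta.
have pair m1 : \int[m1]_(x in M) g' x - \int[m1]_(x in M) g x = \int[m1]_(x in M) D x.
  by rewrite /D RintegralB//; exact: Prob_integrable.
rewrite !pair (Rintegral_density mM mn)// (Rintegral_density mM mn')//.
rewrite (Rintegral_density mM Mq')//.
have i1 := bounded_integrableM mM mD bD (density_integrable mM mn).
have i2 := bounded_integrableM mM mD bD (density_integrable mM mn').
have i3 := bounded_integrableM mM mD bD (density_integrable mM Mq').
have iq := density_integrable mM Mq'.
(* Pairing D with the error n' - (1 - l) n - l q(g') gives B = (1 - l) A + l C up to l delta eta, in
   the notation below. Hence A - C, the correction in [KL_gibbs_change], is (A - B) / l up to delta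
   eta. *)
pose k x := D x * n' x - (1 - l) * (D x * n x) - l * (D x * q g' x).
have i1' := integrable_scale mM (1 - l) i1; have i3' := integrable_scale mM l i3.
have i21 := integrable_sub mM i2 i1'.
have ik : leb.-integrable M (EFin \o k) := integrable_sub mM i21 i3'.
have := le_normr_Rintegral mM ik.
rewrite (RintegralB mM i21 i3') (RintegralB mM i2 i1') !RintegralZl//.
set A := \int[leb]_(x in M) (D x * n x); set B := \int[leb]_(x in M) (D x * n' x).
set C := \int[leb]_(x in M) (D x * q g' x) => H.
have H' : \int[leb]_(x in M) `|k x| <= \int[leb]_(x in M) (l * (delta * eta) * q g' x).
  apply: le_Rintegral => //.
  - exact: integrable_norm.
  - exact: integrable_scale.
  - move=> x Mx; rewrite /k.
    have -> : D x * n' x - (1 - l) * (D x * n x) - l * (D x * q g' x) =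
      D x * (n' x - (1 - l) * n x - l * q g' x) by ring.
    rewrite normrM (_ : l * _ * _ = delta * (l * eta * q g' x)); last by ring.
    by rewrite ler_pM//; [exact: gg'|exact: close].
rewrite RintegralZl// (density_Rintegral1 mM Mq') mulr1 in H'.
have : l * ((1 - l) * (A - C)) <= (1 - l) * (A - B) + l * (delta * eta).
  have := le_trans H H'; rewrite ler_norml => /andP[H1 H2].
  have : 0 <= l * (delta * eta) by lra.
  move: H1 H2; move: (l * (delta * eta)) => e; nra.
move=> G; rewrite -(ler_pM2l l0); apply: le_trans G _.
rewrite mulrDr le_eqVlt; apply/orP; left; apply/eqP; field.
by rewrite gt_eqF.
Qed.

(* First-order optimality: perturb towards the best response and let the weight
   tend to 0. *)
Lemma minimizer_gibbs_density (J : Prob M -> R) (G : Prob M -> 'rV[R]_d -> R) m n C :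
  (forall m1 m2, \int[m2]_(x in M) G m1 x - \int[m1]_(x in M) G m1 x <= J m2 - J m1) ->
  (forall m1, measurable_fun M (G m1)) -> (forall m1, bounded_on M (G m1)) ->
  is_density m n -> (KL m mpi < +oo)%E ->
  (forall m', ((J m)%:E + KL m mpi <= (J m')%:E + KL m' mpi)%E) ->
  (forall m' e x, m' = gibbs m (tilt (G m)) -> 0 < e -> e < 1 -> M x ->
     `|G (mix e m m') x - G m x| <= C * e) ->
  is_density m (q (G m)).
Proof.
move=> Jconv mG bG mn Em opt lip.
set m' := gibbs m (tilt (G m)).
have Mq : is_density m' (q (G m)) := gibbs_is_density mM mU U1 m (mG m) (bG m).
have q0 x : M x -> 0 < q (G m) x by move=> _; exact: gibbs_density_gt0.
have w0 (x : 'rV[R]_d) : M x -> 0 < expR (- U x) by move=> _; exact: expR_gt0.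
have KLm := KL_tilt mM mU U1 m mpiw mn (mG m) (bG m).
have E0 := KL_ge0 mM mn mpiw w0; have K0 := KL_ge0 mM mn Mq q0.
have [n1 n0 _] := mn; have [q1 _ _] := Mq.
have ni := density_integrable mM mn; have qi := density_integrable mM Mq.
(* Optimality of m and the gradient inequality for J at [me] bound KL (m | m') - KL (me | m') by the
   integral of G me - G m against me - m, at most C e times 2 e. By convexity the same difference is
   at least e KL (m | m'). *)
have key e : 0 < e -> e < 1 -> (KL m m' <= (2 * C * e)%:E)%E.
  move=> e0 e1; pose me := mix e m m'.
  have mde : is_density me (fun x => (1 - e) * n x + e * q (G m) x).
    by apply: mix_density => //; exact: ltW.
  have KLme := KL_tilt mM mU U1 m mpiw mde (mG m) (bG m).
  have Ee0 := KL_ge0 mM mde mpiw w0.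
  have mixle : (KL me m' <= (1 - e)%:E * KL m m' + (e * 0 ^+ 2)%:E)%E.
    apply: (KL_mixture mM mn mde Mq q0 e0 e1 ler01) => x Mx.
    by rewrite addrAC addrK subrr normr0 mulr0 mul0r.
  have := opt me; have := Jconv me m.
  have [si ss sle] := mix_density_close mM e0 mn Mq.
  have mD : measurable_fun M (fun x => G me x - G m x) by exact: measurable_funB.
  have Dle x : M x -> `|G me x - G m x| <= C * e by exact: lip.
  have := Rintegral_density_diff_le mM mn mde si sle mD Dle.
  have pair m1 : \int[m1]_(x in M) (G me x - G m x) =
      \int[m1]_(x in M) G me x - \int[m1]_(x in M) G m x.
    by rewrite RintegralB//; exact: Prob_integrable.
  rewrite !pair ss => lipi Jc; move: lipi; rewrite ler_norml => /andP[_ lipi].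
  move: KLm KLme mixle Em E0 Ee0 K0; rewrite -/m'.
  case: (KL m m') => [k| |]//; case: (KL m mpi) => [a| |]//.
  case: (KL me mpi) => [b| |]//; last first.
    by move=> _ ->.
  move=> [] -> -> /=; rewrite -EFinM -EFinD -!EFinD !lee_fin => mixle _ _ _ _ ineq.
  rewrite -(ler_pM2l e0); move: mixle; rewrite expr0n/= mulr0 addr0; lra.
have KL0 : (KL m m' <= 0)%E.
  apply/lee_addgt0Pr => eps eps0; rewrite add0e.
  have [C0|C0] := leP C 0.
    apply: le_trans (key 2^-1 _ _) _; [lra|lra|].
    by rewrite lee_fin; lra.
  pose e := Num.min 2^-1 (eps / (2 * C)).
  have e0 : 0 < e by rewrite lt_min divr_gt0 ?mulr_gt0// invr_gt0 ltr0n.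
  have e1 : e < 1 by rewrite gt_min; apply/orP; left; lra.
  apply: le_trans (key e e0 e1) _; rewrite lee_fin mulrC -ler_pdivlMr ?mulr_gt0//.
  by rewrite ge_min lexx orbT.
(* Pinsker's inequality turns vanishing entropy into equality on Borel sets. *)
have eqA A : measurable A -> m A = m' A.
  move=> mA; have := le_trans (pinsker_abs mM mn Mq q0 mA) KL0.
  rewrite lee_fin pmulr_rle0// => sq0.
  have : (fine (m A) - fine (m' A)) ^+ 2 == 0 by rewrite eq_le sq0 sqr_ge0.
  rewrite sqrf_eq0 subr_eq0 => /eqP H.
  by rewrite -[LHS]fineK ?fin_num_measure// H fineK ?fin_num_measure.
have [_ qge qE] := Mq; split => // A mA AM.
by rewrite eqA// qE.
Qed.

End best_response.

(** * The flow *)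

Section flow_equation.
Context {R : realType}.
Implicit Types (f psi : R -> R) (s t l alpha : R).

Lemma has_derivative_right f t l : 0 <= t -> has_derivative_on_nonneg f t l ->
  ((s - t)^-1 * (f s - f t)) @[s --> t^'+] --> l.
Proof.
move=> t0 H; apply: cvg_trans H; apply: cvg_app => P.
move=> HP; have {}HP : \forall s \near t, s != t -> 0 <= s -> P s by exact: HP.
suff : \forall s \near t, t < s -> P s by [].
apply: filterS HP => s HPs ts.
by apply: HPs; [rewrite gt_eqF|exact: ltW (le_lt_trans t0 ts)].
Qed.

(** At t > 0 the constraint s >= 0 is void near t, so the derivative is two-sided. *)
Lemma has_derivative_is_derive f t l : 0 < t -> has_derivative_on_nonneg f t l ->
  is_derive (t : R) (1 : R) f l.
Proof.
move=> t0 H.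
have cv : h^-1 *: (f (h *: 1 + t) - f t) @[h --> 0^'] --> l.
  move/cvgrPdist_lt : H => H; apply/cvgrPdist_lt => e e0.
  have := H e e0; rewrite /within /dnbhs /within /= => Hn.
  have t00 : \forall h \near (0 : R), 0 <= h + t.
    by have := @Nlt_nbhsl R 0 t; rewrite oppr0 => /(_ t0); apply: filterS => h; lra.
  have sh : \forall h \near (0 : R), h + t != t -> 0 <= h + t ->
       `|l - (h + t - t)^-1 * (f (h + t) - f t)| < e.
    have : (h + t) @[h --> (0 : R)] --> t.
      rewrite -[X in _ --> X]add0r; apply: cvgD; [exact: cvg_id|exact: cvg_cst].
    by move/(_ _ Hn).
  suff : \forall h \near (0 : R), h != 0 ->
      `|l - h^-1 *: (f (h *: 1 + t) - f t)| < e by [].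
  apply: filterS2 sh t00 => h + ht h0.
  rewrite [h *: 1](_ : _ = h); last by rewrite /GRing.scale/= mulr1.
  by rewrite /GRing.scale/= addrK; apply => //; rewrite -subr_eq0 addrK.
split; first by apply/cvg_ex; exists l.
by apply: cvg_lim.
Qed.

(** Gives the one-sided continuity that Rolle's argument needs at the left endpoint, which may be
    0. *)
Lemma has_derivative_cvg_right f t l : 0 <= t -> has_derivative_on_nonneg f t l ->
  f @ t^'+ --> f t.
Proof.
move=> t0 /(has_derivative_right t0) H.
have : (f t + (s - t) * ((s - t)^-1 * (f s - f t))) @[s --> t^'+] --> f t + 0 * l.
  apply: cvgD; first exact: cvg_cst.
  apply: cvgM => //; rewrite -(subrr t); apply: cvgB; last exact: cvg_cst.
  by apply: cvg_at_right_filter; exact: cvg_id.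
rewrite mul0r addr0; apply: cvg_trans; apply: near_eq_cvg; near=> s.
rewrite mulrA divff ?mul1r ?subrKC// subr_eq0 gt_eqF//.
Unshelve. all: by end_near. Qed.

(** Takes the place of the variation of constants formula, without any regularity of [psi] in time:
    after multiplication by the integrating factor exp (alpha u), Rolle's theorem applies. *)
Lemma flow_mean_value f psi alpha s t : 0 < alpha -> 0 <= s -> s < t ->
  (forall u, 0 <= u -> has_derivative_on_nonneg f u (alpha * (psi u - f u))) ->
  exists xi, [/\ s < xi, xi < t & f t = expR (- (alpha * (t - s))) * f s +
    (1 - expR (- (alpha * (t - s)))) * psi xi].
Proof.
move=> a0 s0 st fd.
pose E u := expR (alpha * u).
have Est : E s < E t by rewrite /E ltr_expR ltr_pM2l.
(* The constant is chosen so that h s = h t. Since h' = alpha E (psi - c), Rolle's point satisfies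
   psi xi = c, and solving the definition of c for f t gives the formula. *)
pose c := (E t * f t - E s * f s) / (E t - E s).
pose h u := E u * (f u - c).
have dE (u : R) : is_derive (u : R) (1 : R) E (alpha * E u).
  by rewrite /E; apply: is_derive_eq; rewrite /GRing.scale/=; ring.
have dh (u : R) : 0 < u -> is_derive (u : R) (1 : R) h (alpha * E u * (psi u - c)).
  move=> u0; have df := has_derivative_is_derive u0 (fd _ (ltW u0)).
  rewrite /h; apply: is_derive_eq; rewrite /GRing.scale/=; ring.
have [| |xi] := @MVT R h (fun u => alpha * E u * (psi u - c)) s t st.
- by move=> u; rewrite in_itv/= => /andP[su _]; apply: dh; exact: le_lt_trans su.
- have ch (u : R) : 0 < u -> {for u, continuous h}.
    by move=> u0; apply/differentiable_continuous/derivable1_diffP; case: (dh u u0).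
  apply/(continuous_within_itvP _ st); split.
  + by move=> u; rewrite in_itv/= => /andP[su _]; apply: ch; exact: le_lt_trans su.
  + apply: cvgM.
      apply: cvg_at_right_filter; apply/differentiable_continuous/derivable1_diffP.
      by case: (dE s).
    apply: cvgB; last exact: cvg_cst.
    exact: has_derivative_cvg_right (fd _ s0).
  + by apply: cvg_at_left_filter; apply: ch; exact: le_lt_trans st.
rewrite in_itv/= => /andP[sxi xit] hh.
exists xi; split => //.
have hst : h t = h s.
  rewrite /h /c; field; by rewrite subr_eq0 gt_eqF.
move: hh; rewrite hst subrr => /esym/eqP.
rewrite !mulf_eq0 (gt_eqF a0) (gt_eqF (expR_gt0 _)) !subr_eq0 (gt_eqF st) orbF/=.
move=> /eqP ->.
have -> : expR (- (alpha * (t - s))) = E s / E t.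
  by rewrite /E -expRN -expRD; congr expR; ring.
rewrite /c; field.
by rewrite subr_eq0 (gt_eqF Est) gt_eqF// expR_gt0.
Qed.

End flow_equation.

(** * Iteration of a one-step contraction *)

Section discrete_gronwall.
Context {R : realType}.
Implicit Types (L : R -> \bar R) (t h alpha C : R).

(* Local errors O(h^2) add up to O(h) over the t / h steps, so neither regularity of L
   in time nor its derivative is needed. *)
Lemma discrete_gronwall L alpha C (h0 : R) : 0 <= alpha -> 0 <= C -> 0 < h0 -> (L 0%R < +oo)%E ->
  (0 <= L 0%R)%E ->
  (forall t h, 0 <= t -> 0 < h -> h <= h0 ->
     (L (t + h)%R <= (expR (- (alpha * h)))%:E * L t + (C * h ^+ 2)%:E)%E) ->
  forall t, 0 <= t -> (L t <= (expR (- (alpha * t)))%:E * L 0%R)%E.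
Proof.
move=> a0 C0 h00 Loo L0 step t t0.
have [r Lr] : exists r, L 0 = r%:E.
  by move: Loo L0; case: (L 0) => [r| |]//; exists r.
move: t0; rewrite le_eqVlt => /predU1P[<-|t0]; first by rewrite mulr0 oppr0 expR0 mul1e.
(* The contraction factors multiply; being at most 1, they do not amplify the errors of earlier
   steps. *)
have iter h (k : nat) : 0 < h -> h <= h0 ->
    (L (k%:R * h)%R <= (expR (- (alpha * (k%:R * h))) * r + k%:R * (C * h ^+ 2))%:E)%E.
  move=> hp hh; elim: k => [|k IH]; first by rewrite !mul0r mulr0 oppr0 expR0 mul1r addr0 Lr.
  have -> : k.+1%:R * h = k%:R * h + h by rewrite -natr1; ring.
  apply: le_trans (step _ _ _ hp hh) _; first by rewrite mulr_ge0// ltW.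
  have e0 := expR_gt0 (- (alpha * h)).
  apply: (@le_trans _ _ ((expR (- (alpha * h)))%:E *
     (expR (- (alpha * (k%:R * h))) * r + k%:R * (C * h ^+ 2))%:E + (C * h ^+ 2)%:E)%E).
    by rewrite leeD2r// lee_pmul2l.
  rewrite -EFinM -EFinD lee_fin mulrDr [_ * (_ * r)]mulrA -expRD -natr1.
  have -> : - (alpha * h) + - (alpha * (k%:R * h)) = - (alpha * (k%:R * h + h)) by ring.
  rewrite -addrA lerD2l mulrDl mul1r lerD2r ler_piMl//.
    by rewrite mulr_ge0// mulr_ge0// sqr_ge0.
  rewrite -expR0 ler_expR oppr_le0.
  by rewrite mulr_ge0// ltW.
rewrite Lr -EFinM; apply/lee_addgt0Pr => eps eps0; rewrite -EFinD.
(* More than B steps make the step size t / N at most h0 and the total error C t^2 / N at most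
   eps. *)
pose B := t / h0 + C * t ^+ 2 / eps.
have B1 : 0 < t / h0 by rewrite divr_gt0.
have B2 : 0 <= C * t ^+ 2 / eps by rewrite divr_ge0 ?mulr_ge0 ?sqr_ge0// ltW.
have [N BN] : exists N : nat, B < N%:R.
  exists (Num.bound B); apply: le_lt_trans (archi_boundP _); first exact: lexx.
  by rewrite addr_ge0// ltW.
have N0 : 0 < N%:R :> R by apply: lt_trans BN; rewrite ltr_pwDl.
have tN0 : 0 < t / N%:R by rewrite divr_gt0.
have := iter (t / N%:R) N tN0; rewrite mulrCA divff ?gt_eqF// mulr1.
move=> /(_ _)/le_trans; apply.
  by rewrite ler_pdivrMr// mulrC -ler_pdivrMr// ltW// (le_lt_trans _ BN)// lerDl.
rewrite lee_fin lerD2l expr_div_n.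
have -> : N%:R * (C * (t ^+ 2 / N%:R ^+ 2)) = C * t ^+ 2 / N%:R.
  by field; rewrite gt_eqF.
rewrite ler_pdivrMr// [leRHS]mulrC -ler_pdivrMr// ltW// (le_lt_trans _ BN)// lerDr.
exact: ltW.
Qed.

End discrete_gronwall.

(** * Regularity of the densities along the flow *)

Section player_flow.
Context (R : realType) (d : nat) (M : set 'rV[R]_d) (mM : measurable M).
Local Notation leb := (@lebesgue_Rn R d).
Variables (U : 'rV[R]_d -> R).
Hypothesis mU : measurable_fun M U.
Hypothesis U1 : (\int[leb]_(x in M) (expR (- U x))%:E = 1)%E.
Local Notation q g := (gibbs_density M (tilt U g)).
Implicit Types (s t : R).
Variables (alpha K : R) (n G : R -> 'rV[R]_d -> R).
Hypothesis alpha0 : 0 < alpha.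
Hypothesis mG : forall t, 0 <= t -> measurable_fun M (G t).
Hypothesis GK : forall t x, 0 <= t -> M x -> `|G t x| <= K.
Hypothesis n0 : forall t x, 0 <= t -> M x -> 0 <= n t x.
Hypothesis flow : forall t x, 0 <= t -> M x ->
  has_derivative_on_nonneg (n ^~ x) t (alpha * (q (G t) x - n t x)).

Let bG t : 0 <= t -> bounded_on M (G t).
Proof. by move=> t0; exists K => x; exact: GK. Qed.

Let mean_value s t x : 0 <= s -> s < t -> M x -> exists xi, [/\ s < xi, xi < t &
  n t x = expR (- (alpha * (t - s))) * n s x +
    (1 - expR (- (alpha * (t - s)))) * q (G xi) x].
Proof.
move=> s0 st Mx; apply: (@flow_mean_value R (n ^~ x) (fun u => q (G u) x)) => // u u0.
exact: flow.
Qed.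

(** In the mean value formula the weight is at most alpha (t - s), and the Gibbs density is at most
    exp (2 K) times the reference density. The resulting bound is integrable in x, as the Lipschitz
    estimates for the potentials require. *)
Lemma flow_density_lipschitz s t x : 0 <= s -> s <= t -> M x ->
  `|n t x - n s x| <= alpha * (t - s) * (expR (2 * K) * expR (- U x) + n s x).
Proof.
move=> s0 st Mx; move: st; rewrite le_eqVlt => /predU1P[<-|st].
  by rewrite !subrr normr0 mulr0 mul0r.
have [xi [sxi xit ->]] := mean_value s0 st Mx.
have xi0 : 0 <= xi by exact: le_trans (ltW sxi).
set e := expR _; have e1 : 0 <= 1 - e.
  by rewrite subr_ge0 -expR0 ler_expR oppr_le0 mulr_ge0 ?subr_ge0 ?ltW.
have e2 : 1 - e <= alpha * (t - s).
  by rewrite lerBlDl -lerBlDr; have := expR_ge1Dx (- (alpha * (t - s))); rewrite -/e.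
have qle := gibbs_density_le mM mU U1 (mG xi0) (fun x => @GK xi x xi0) Mx.
have q0 := gibbs_density_gt0 mM mU U1 x (mG xi0) (bG xi0).
have ns0 := n0 s0 Mx.
rewrite (_ : _ - n s x = (1 - e) * (q (G xi) x - n s x)); last by ring.
rewrite normrM (ger0_norm e1) ler_pM//.
rewrite ler_norml; move: (expR (2 * K) * _) (q _ _) (n s x) qle q0 ns0 => a b c; lra.
Qed.

(** The intermediate time depends on x, so the potentials must be close to the final one uniformly
    over [s, t]. *)
Lemma flow_density_close s t delta x : 0 <= s -> s < t -> M x ->
  (forall u y, s <= u -> u <= t -> M y -> `|G u y - G t y| <= delta) -> delta <= 4^-1 ->
  `|n t x - expR (- (alpha * (t - s))) * n s x
     - (1 - expR (- (alpha * (t - s)))) * q (G t) x| <=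
  (1 - expR (- (alpha * (t - s)))) * (4 * delta) * q (G t) x.
Proof.
move=> s0 st Mx Gd d4.
have [xi [sxi xit ->]] := mean_value s0 st Mx.
have xi0 : 0 <= xi by exact: le_trans (ltW sxi).
have t0 : 0 <= t by exact: le_trans (ltW st).
set e := expR _; have e1 : 0 <= 1 - e.
  by rewrite subr_ge0 -expR0 ler_expR oppr_le0 mulr_ge0 ?subr_ge0 ?ltW.
rewrite [_ + _ - _ - _](_ : _ = (1 - e) * (q (G xi) x - q (G t) x)); last by ring.
rewrite normrM (ger0_norm e1) -mulrA ler_wpM2l//.
apply: gibbs_density_close => //; [exact: mG|exact: bG|exact: mG|exact: bG|].
by move=> y My; apply: Gd => //; exact: ltW.
Qed.

End player_flow.

Section ereal_pairs.
Context {R : realType}.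
Local Open Scope ereal_scope.

Lemma le_add_shift (a b A B : \bar R) (x y z : R) : a <= A + x%:E -> b <= B + y%:E ->
  (x + y <= z)%R -> a + b <= A + B + z%:E.
Proof.
move=> aA bB xyz; apply: (le_trans (leeD aA bB)).
by rewrite addeACA -EFinD leeD2l// lee_fin.
Qed.

End ereal_pairs.

(** * Two players *)

Section two_players.
Context (R : realType) (d : nat) (X Y : set 'rV[R]_d).
Hypotheses (mX : measurable X) (mY : measurable Y).
Local Notation leb := (@lebesgue_Rn R d).
Implicit Types (nu nus : Prob X) (mu mus : Prob Y) (s t h : R).
Variables (UX UY : 'rV[R]_d -> R) (ppi : Prob X) (prho : Prob Y).
Hypotheses (mUX : measurable_fun X UX) (mUY : measurable_fun Y UY).
Hypothesis UX1 : (\int[leb]_(x in X) (expR (- UX x))%:E = 1)%E.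
Hypothesis UY1 : (\int[leb]_(y in Y) (expR (- UY y))%:E = 1)%E.
Hypothesis ppiE : is_density ppi (fun x => expR (- UX x)).
Hypothesis prhoE : is_density prho (fun y => expR (- UY y)).
(* gX and gY stand for (2 / sigma^2) dF/dnu and - (2 / sigma^2) dF/dmu: with this
   sign both best responses are Gibbs measures exp (- g - U) / Z, and
   convexity-concavity of F is monotonicity of the pair (gX, gY). *)
Variables (gX gY : Prob X -> Prob Y -> 'rV[R]_d -> R) (K L : R).
Hypothesis L0 : 0 <= L.
Hypothesis mgX : forall nu mu, measurable_fun X (gX nu mu).
Hypothesis mgY : forall nu mu, measurable_fun Y (gY nu mu).
Hypothesis gXK : forall nu mu x, X x -> `|gX nu mu x| <= K.
Hypothesis gYK : forall nu mu y, Y y -> `|gY nu mu y| <= K.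
Hypothesis monotone : forall nu mu nu' mu',
  ((\int[nu]_(x in X) gX nu' mu' x - \int[nu]_(x in X) gX nu mu x) -
   (\int[nu']_(x in X) gX nu' mu' x - \int[nu']_(x in X) gX nu mu x)) +
  ((\int[mu]_(y in Y) gY nu' mu' y - \int[mu]_(y in Y) gY nu mu y) -
   (\int[mu']_(y in Y) gY nu' mu' y - \int[mu']_(y in Y) gY nu mu y)) <= 0.
Hypothesis lipschitz : forall nu mu nu' mu' n n' m m' sX sY,
  is_density nu n -> is_density nu' n' -> is_density mu m -> is_density mu' m' ->
  leb.-integrable X (EFin \o sX) -> leb.-integrable Y (EFin \o sY) ->
  (forall x, X x -> `|n' x - n x| <= sX x) -> (forall y, Y y -> `|m' y - m y| <= sY y) ->
  (forall x, X x -> `|gX nu' mu' x - gX nu mu x| <=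
     L * (\int[leb]_(x in X) sX x + \int[leb]_(y in Y) sY y)) /\
  (forall y, Y y -> `|gY nu' mu' y - gY nu mu y| <=
     L * (\int[leb]_(x in X) sX x + \int[leb]_(y in Y) sY y)).

Local Notation PsiX nu mu := (gibbs nu (tilt UX (gX nu mu))).
Local Notation PhiY nu mu := (gibbs mu (tilt UY (gY nu mu))).
Local Notation qX nu mu := (gibbs_density X (tilt UX (gX nu mu))).
Local Notation qY nu mu := (gibbs_density Y (tilt UY (gY nu mu))).

Let bgX nu mu : bounded_on X (gX nu mu). Proof. by exists K; exact: gXK. Qed.
Let bgY nu mu : bounded_on Y (gY nu mu). Proof. by exists K; exact: gYK. Qed.

Let qX0 nu mu x : X x -> 0 < qX nu mu x.
Proof. by move=> _; exact: gibbs_density_gt0. Qed.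
Let qY0 nu mu y : Y y -> 0 < qY nu mu y.
Proof. by move=> _; exact: gibbs_density_gt0. Qed.

Lemma KL_equilibrium_le nu mu n m nus mus :
  is_density nu n -> is_density mu m ->
  is_density nus (qX nus mus) -> is_density mus (qY nus mus) ->
  (KL nu nus + KL mu mus <= KL nu (PsiX nu mu) + KL mu (PhiY nu mu))%E.
Proof.
move=> nun mum nusq musq.
have DX := gibbs_is_density mX mUX UX1 nus (mgX nus mus) (bgX nus mus).
have DY := gibbs_is_density mY mUY UY1 mus (mgY nus mus) (bgY nus mus).
(* An equilibrium measure and its best response share a density but need not be equal as functions
   on all sets, so the entropies are compared through densities. *)
have -> : KL nu nus = KL nu (PsiX nus mus).
  by rewrite (KL_density mX nun nusq (@qX0 _ _)) (KL_density mX nun DX (@qX0 _ _)).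
have -> : KL mu mus = KL mu (PhiY nus mus).
  by rewrite (KL_density mY mum musq (@qY0 _ _)) (KL_density mY mum DY (@qY0 _ _)).
have HX := KL_gibbs_change mX mUX UX1 ppiE nu nus (mgX nu mu) (bgX nu mu)
  (mgX nus mus) (bgX nus mus) nun.
have HY := KL_gibbs_change mY mUY UY1 prhoE mu mus (mgY nu mu) (bgY nu mu)
  (mgY nus mus) (bgY nus mus) mum.
rewrite -[leRHS]adde0; apply: (le_add_shift HX HY).
have eX g : measurable_fun X g -> bounded_on X g ->
    \int[PsiX nus mus]_(x in X) g x = \int[nus]_(x in X) g x.
  by move=> mg bg; rewrite (Rintegral_density mX DX)// (Rintegral_density mX nusq).
have eY g : measurable_fun Y g -> bounded_on Y g ->
    \int[PhiY nus mus]_(x in Y) g x = \int[mus]_(x in Y) g x.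
  by move=> mg bg; rewrite (Rintegral_density mY DY)// (Rintegral_density mY musq).
rewrite !eX// !eY//; exact: monotone.
Qed.

Section flow.
Variables (alpha : R) (nu : R -> Prob X) (mu : R -> Prob Y) (n m : R -> 'rV[R]_d -> R).
Hypothesis alpha0 : 0 < alpha.
Hypothesis nun : forall t, 0 <= t -> is_density (nu t) (n t).
Hypothesis mum : forall t, 0 <= t -> is_density (mu t) (m t).
Hypothesis flowX : forall t x, 0 <= t -> X x ->
  has_derivative_on_nonneg (n ^~ x) t (alpha * (qX (nu t) (mu t) x - n t x)).
Hypothesis flowY : forall t y, 0 <= t -> Y y ->
  has_derivative_on_nonneg (m ^~ y) t (alpha * (qY (nu t) (mu t) y - m t y)).

Let GX t := gX (nu t) (mu t).
Let GY t := gY (nu t) (mu t).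
Let n_ge0 t x : 0 <= t -> X x -> 0 <= n t x.
Proof. by move=> t0 Xx; have [_ + _] := nun t0; exact. Qed.
Let m_ge0 t y : 0 <= t -> Y y -> 0 <= m t y.
Proof. by move=> t0 Yy; have [_ + _] := mum t0; exact. Qed.

(** Lipschitz constant in time of the potentials: each player's density moves in L^1 at speed at
    most alpha (exp (2 K) + 1), and L multiplies the sum over the two players. *)
Let Lam := 2 * L * (alpha * (expR (2 * K) + 1)).

Lemma flow_potential_lipschitz s t : 0 <= s -> s <= t ->
  (forall x, X x -> `|GX t x - GX s x| <= Lam * (t - s)) /\
  (forall y, Y y -> `|GY t y - GY s y| <= Lam * (t - s)).
Proof.
move=> s0 st; have t0 := le_trans s0 st.
pose sX x := alpha * (t - s) * (expR (2 * K) * expR (- UX x) + n s x).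
pose sY y := alpha * (t - s) * (expR (2 * K) * expR (- UY y) + m s y).
have iX := integrable_scale mX (expR (2 * K)) (reference_integrable mUX UX1).
have iY := integrable_scale mY (expR (2 * K)) (reference_integrable mUY UY1).
have iX' := integrable_add mX iX (density_integrable mX (nun s0)).
have iY' := integrable_add mY iY (density_integrable mY (mum s0)).
have iX2 : leb.-integrable X (EFin \o sX) by exact: integrable_scale.
have iY2 : leb.-integrable Y (EFin \o sY) by exact: integrable_scale.
have IX : \int[leb]_(x in X) sX x = alpha * (t - s) * (expR (2 * K) + 1).
  rewrite RintegralZl// RintegralD//; last exact: density_integrable (nun s0).
  rewrite RintegralZl//; last exact: reference_integrable.
  by rewrite {1}/Rintegral UX1 (density_Rintegral1 mX (nun s0)) mulr1.
have IY : \int[leb]_(x in Y) sY x = alpha * (t - s) * (expR (2 * K) + 1).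
  rewrite RintegralZl// RintegralD//; last exact: density_integrable (mum s0).
  rewrite RintegralZl//; last exact: reference_integrable.
  by rewrite {1}/Rintegral UY1 (density_Rintegral1 mY (mum s0)) mulr1.
have -> : Lam * (t - s) = L * (\int[leb]_(x in X) sX x + \int[leb]_(y in Y) sY y).
  by rewrite IX IY /Lam; ring.
apply: (lipschitz (nun s0) (nun t0) (mum s0) (mum t0) iX2 iY2).
- move=> x Xx; apply: (flow_density_lipschitz mX mUX UX1 alpha0
    (G := GX) _ _ n_ge0 flowX) => //.
  + by move=> u _; exact: mgX.
  + by move=> u y _; exact: gXK.
- move=> y Yy; apply: (flow_density_lipschitz mY mUY UY1 alpha0
    (G := GY) _ _ m_ge0 flowY) => //.
  + by move=> u _; exact: mgY.
  + by move=> u x _; exact: gYK.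
Qed.

Let V t := (KL (nu t) (PsiX (nu t) (mu t)) + KL (mu t) (PhiY (nu t) (mu t)))%E.

Let V_ge0X t : 0 <= t -> (0 <= KL (nu t) (PsiX (nu t) (mu t)))%E.
Proof.
by move=> t0; apply: (KL_ge0 mX (nun t0) (gibbs_is_density mX mUX UX1 _ _ _) (@qX0 _ _)).
Qed.

Let V_ge0Y t : 0 <= t -> (0 <= KL (mu t) (PhiY (nu t) (mu t)))%E.
Proof.
by move=> t0; apply: (KL_ge0 mY (mum t0) (gibbs_is_density mY mUY UY1 _ _ _) (@qY0 _ _)).
Qed.

(** With e = Lam h, [KL_gibbs_step] applies to each player with delta = e and eta = 4 e, where e <=
    1/4 ensures eta <= 1. Each error is 4 e^2 + 16 l e^2 <= 20 e^2, hence 40 for the two. *)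
Lemma lyapunov_step t h : 0 <= t -> 0 < h -> Lam * h <= 4^-1 ->
  (V (t + h)%R <= (expR (- (alpha * h)))%:E * V t + (40 * Lam ^+ 2 * h ^+ 2)%:E)%E.
Proof.
move=> t0 h0 Lh; have th : t < t + h by rewrite ltrDl.
have th0 : 0 <= t + h by rewrite addr_ge0// ltW.
pose l := 1 - expR (- (alpha * h)).
have l1E : 1 - l = expR (- (alpha * h)) by rewrite /l subKr.
have l0 : 0 < l by rewrite subr_gt0 -expR0 ltr_expR oppr_lt0 mulr_gt0.
have l1 : l < 1 by rewrite -subr_gt0 l1E expR_gt0.
have Lam0 : 0 <= Lam.
  by rewrite mulr_ge0 ?mulr_ge0// ?addr_ge0 ?expR_ge0// ltW.
have L40 : 0 <= 4 * (Lam * h) by rewrite mulr_ge0// mulr_ge0// ltW.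
have L41 : 4 * (Lam * h) <= 1 by lra.
have dX u x : t <= u -> u <= t + h -> X x -> `|GX u x - GX (t + h) x| <= Lam * h.
  move=> tu uth Xx; rewrite distrC.
  have [+ _] := flow_potential_lipschitz (le_trans t0 tu) uth.
  by move/(_ _ Xx)/le_trans; apply; rewrite ler_wpM2l//; lra.
have dY u y : t <= u -> u <= t + h -> Y y -> `|GY u y - GY (t + h) y| <= Lam * h.
  move=> tu uth Yy; rewrite distrC.
  have [_ +] := flow_potential_lipschitz (le_trans t0 tu) uth.
  by move/(_ _ Yy)/le_trans; apply; rewrite ler_wpM2l//; lra.
have htE : t + h - t = h by rewrite addrAC subrr add0r.
have cX x : X x -> `|n (t + h) x - (1 - l) * n t x - l * qX (nu (t + h)) (mu (t + h)) x|
    <= l * (4 * (Lam * h)) * qX (nu (t + h)) (mu (t + h)) x.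
  move=> Xx; have := flow_density_close mX mUX UX1 alpha0 (n := n) (G := GX) (K := K)
    (fun u _ => mgX _ _) (fun u z _ => @gXK _ _ z) flowX t0 th Xx dX Lh.
  by rewrite htE -l1E subKr.
have cY y : Y y -> `|m (t + h) y - (1 - l) * m t y - l * qY (nu (t + h)) (mu (t + h)) y|
    <= l * (4 * (Lam * h)) * qY (nu (t + h)) (mu (t + h)) y.
  move=> Yy; have := flow_density_close mY mUY UY1 alpha0 (n := m) (G := GY) (K := K)
    (fun u _ => mgY _ _) (fun u z _ => @gYK _ _ z) flowY t0 th Yy dY Lh.
  by rewrite htE -l1E subKr.
have HX := KL_gibbs_step mX mUX UX1 ppiE (nu t) (nu (t + h)) (mgX _ _) (bgX _ _) (mgX _ _)
  (bgX _ _) (nun t0) (nun th0) l0 l1 L40 L41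
  (fun x Xx => eq_ind _ (fun z => z <= _) (dX t x (lexx _) (ltW th) Xx) _ (distrC _ _)) cX.
have HY := KL_gibbs_step mY mUY UY1 prhoE (mu t) (mu (t + h)) (mgY _ _) (bgY _ _) (mgY _ _)
  (bgY _ _) (mum t0) (mum th0) l0 l1 L40 L41
  (fun x Xx => eq_ind _ (fun z => z <= _) (dY t x (lexx _) (ltW th) Xx) _ (distrC _ _)) cY.
rewrite -l1E ge0_muleDr ?V_ge0X ?V_ge0Y//.
apply: (le_add_shift HX HY).
have := monotone (nu t) (mu t) (nu (t + h)) (mu (t + h)).
move: (_ - (\int[nu (t + h)]_(x in X) _ - _)) (_ - (\int[mu (t + h)]_(x in Y) _ - _)).
move=> a b ab.
(* Only the sum of the two pairings has a sign; it survives because both players have the same rate,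
   hence the same factor (1 - l) / l. *)
have : (1 - l) / l * a + (1 - l) / l * b <= 0.
  rewrite -mulrDr mulr_ge0_le0//; apply: divr_ge0; last exact: ltW.
  by rewrite subr_ge0 ltW.
have : l * (4 * (Lam * h)) ^+ 2 <= (4 * (Lam * h)) ^+ 2.
  by rewrite ler_piMl ?sqr_ge0// ltW.
have -> : 40 * Lam ^+ 2 * h ^+ 2 = 40 * (Lam * h) ^+ 2 by ring.
have E4 (e : R) : e * (4 * e) = 4 * e ^+ 2 by ring.
have E16 (e : R) : (4 * e) ^+ 2 = 16 * e ^+ 2 by ring.
rewrite E4 !E16; move: ((1 - l) / l * a) ((1 - l) / l * b) => a1 b1.
by move: ((Lam * h) ^+ 2) => e; move: (l * (16 * e)) => z; lra.
Qed.

Lemma lyapunov_decay t : 0 <= t -> (V 0%R < +oo)%E ->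
  (V t <= (expR (- (alpha * t)))%:E * V 0%R)%E.
Proof.
move=> t0 V0; have Lam0 : 0 <= Lam.
  by rewrite mulr_ge0 ?mulr_ge0// ?addr_ge0 ?expR_ge0// ltW.
(* The summand 1 keeps the maximal step well defined when Lam = 0. *)
apply: (@discrete_gronwall R V alpha (40 * Lam ^+ 2) (4 * (Lam + 1))^-1) => //.
- exact: ltW.
- by rewrite mulr_ge0// sqr_ge0.
- by rewrite invr_gt0 mulr_gt0// ltr_wpDl.
- by rewrite adde_ge0 ?V_ge0X ?V_ge0Y.
- move=> s h s0 h0 hle; apply: lyapunov_step => //.
  have L1 : 0 < Lam + 1 by rewrite ltr_wpDl.
  apply: (@le_trans _ _ ((Lam + 1) * h)); first by rewrite ler_pM2r// lerDl.
  rewrite mulrC -ler_pdivlMr// (le_trans hle)// invfM; lra.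
Qed.

End flow.

End two_players.

Lemma gibbs_density_congr (R : realType) (d : nat) (M : set 'rV[R]_d) h h' :
  {in M, h =1 h'} -> {in M, gibbs_density M h =1 gibbs_density M h'}.
Proof.
move=> hh x xM; rewrite /gibbs_density (hh x xM); congr (_ / _).
by apply: eq_Rintegral => y yM; rewrite (hh y yM).
Qed.

(** Serves to pass between the prescribed initial measures and the flow at time 0, which agree only
    on Borel sets; the default values of [gibbs] may differ as well. *)
Lemma KL_gibbs_congr (R : realType) (d : nat) (M : set 'rV[R]_d) (U : 'rV[R]_d -> R)
    (m m' mz mz' : Prob M) n g g' :
  measurable M -> measurable_fun M U ->
  (\int[@lebesgue_Rn R d]_(x in M) (expR (- U x))%:E = 1)%E ->
  measurable_fun M g -> bounded_on M g -> measurable_fun M g' -> bounded_on M g' ->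
  is_density m n -> is_density m' n -> (forall x, M x -> g x = g' x) ->
  KL m (gibbs mz (tilt U g)) = KL m' (gibbs mz' (tilt U g')).
Proof.
move=> mM mU U1 mg bg mg' bg' mn mn' gg'.
have D := gibbs_is_density mM mU U1 mz mg bg.
have D' := gibbs_is_density mM mU U1 mz' mg' bg'.
rewrite (KL_density mM mn D); last by move=> x _; exact: gibbs_density_gt0.
rewrite (KL_density mM mn' D'); last by move=> x _; exact: gibbs_density_gt0.
apply: eq_integral => x xM; congr (ent _ _)%:E.
by apply: gibbs_density_congr => // y /set_mem My; rewrite /tilt gg'.
Qed.

Lemma Prob_nonempty (R : realType) (d : nat) (M : set 'rV[R]_d) (m : Prob M) : M !=set0.
Proof.
apply/set0P/negP => /eqP /(congr1 (prob_val m)).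
by rewrite measure0 prob_supp => /eqP; rewrite eqe oner_eq0.
Qed.

(** * Optimality of each player, extracted from the payoff *)

Section equilibrium.
Context {R : realType}.
Local Open Scope ereal_scope.
Implicit Types (c f : R) (A B : \bar R).

(** The inequality rearranges to c (A + B) <= f2 - f1. At an equilibrium it arises from deviations
    to the reference measures, whose own entropies are the zeros in the statement. *)
Lemma payoff_finite c f1 f2 A B : (0 < c)%R -> 0 <= A -> 0 <= B ->
  f1%:E + c%:E * (A - 0) <= f2%:E + c%:E * (0 - B) -> A < +oo /\ B < +oo.
Proof.
move=> c0; rewrite sube0 sub0e; case: A => [a| |]//; case: B => [b| |]//= _ _.
- by rewrite !ltry.
- by rewrite mulrNy gtr0_sg// mul1e addeNy// -EFinM -EFinD leeNy_eq.
- by rewrite mulry gtr0_sg// mul1e addey// -EFinN -EFinM -EFinD leye_eq.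
- by rewrite mulry gtr0_sg// mul1e addey// mulrNy gtr0_sg// mul1e addeNy.
Qed.

(** Cancels the finite entropy of the opponent and rescales to the form J + KL used in
    [minimizer_gibbs_density]. *)
Lemma payoff_minimizer c f1 f2 A A' B : (0 < c)%R -> A \is a fin_num -> B \is a fin_num ->
  f1%:E + c%:E * (A - B) <= f2%:E + c%:E * (A' - B) ->
  (c^-1 * f1)%:E + A <= (c^-1 * f2)%:E + A'.
Proof.
move=> c0; case: A => [a| |]//; case: B => [b| |]// _ _.
case: A' => [a'| |]; last 2 first.
- by rewrite addey// leey.
- by rewrite addNye mulrNy gtr0_sg// mul1e addeNy// -EFinB -EFinM -EFinD leeNy_eq.
rewrite -!EFinB -!EFinM -!EFinD !lee_fin => H.
by rewrite -(ler_pM2l c0) !mulrDr !mulrA divff ?gt_eqF// !mul1r; lra.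
Qed.

Lemma payoff_maximizer c f1 f2 A B B' : (0 < c)%R -> A \is a fin_num -> B \is a fin_num ->
  f2%:E + c%:E * (A - B') <= f1%:E + c%:E * (A - B) ->
  (c^-1 * - f1)%:E + B <= (c^-1 * - f2)%:E + B'.
Proof.
move=> c0; case: A => [a| |]//; case: B => [b| |]// _ _.
case: B' => [b'| |]; last 2 first.
- by rewrite addey// leey.
- by rewrite mulry gtr0_sg// mul1e addey// -EFinN -EFinD -EFinM -EFinD leye_eq.
rewrite -!EFinB -!EFinM -!EFinD !lee_fin => H.
by rewrite -(ler_pM2l c0) !mulrDr !mulrA divff ?gt_eqF// !mul1r; lra.
Qed.

End equilibrium.

(** * Exponential convergence to the equilibrium *)

Theorem corollary2p4 (R : realType) (d : nat) (X Y : set 'rV[R]_d)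
  (mX : measurable X) (mY : measurable Y)
  (Upi Urho : 'rV[R]_d -> R)
  (mUpi : measurable_fun X Upi) (mUrho : measurable_fun Y Urho)
  (Upi1 : (\int[@lebesgue_Rn R d]_(x in X) (expR (- Upi x))%:E = 1)%E)
  (Urho1 : (\int[@lebesgue_Rn R d]_(y in Y) (expR (- Urho y))%:E = 1)%E)
  (ppi : Prob X) (prho : Prob Y)
  (ppiE : is_density ppi (fun x => expR (- Upi x)))
  (prhoE : is_density prho (fun y => expR (- Urho y)))
  (sigma alpha : R) (sigma_gt0 : 0 < sigma) (alpha_gt0 : 0 < alpha)
  (F : Prob X -> Prob Y -> R)
  (DnuF DmuF : Prob X -> Prob Y -> 'rV[R]_d -> R)
  (D2nunuF D2munuF D2mumuF D2numuF :
    Prob X -> Prob Y -> 'rV[R]_d -> 'rV[R]_d -> R)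
  (DnuFP : forall mu : Prob Y,
    is_flat_derivative (fun nu : Prob X => F nu mu) (fun nu => DnuF nu mu))
  (DmuFP : forall nu : Prob X,
    is_flat_derivative (fun mu : Prob Y => F nu mu) (fun mu => DmuF nu mu))
  (F_convex : forall (nu nu' : Prob X) (mu : Prob Y),
    F nu' mu - F nu mu >=
    \int[nu']_(x in X) DnuF nu mu x - \int[nu]_(x in X) DnuF nu mu x)
  (F_concave : forall (nu : Prob X) (mu mu' : Prob Y),
    F nu mu' - F nu mu <=
    \int[mu']_(y in Y) DmuF nu mu y - \int[mu]_(y in Y) DmuF nu mu y)
  (DF_bounded : exists Cnu Cmu : R, [/\ 0 < Cnu, 0 < Cmu &
    forall (nu : Prob X) (mu : Prob Y) x y, X x -> Y y ->
      `|DnuF nu mu x| <= Cnu /\ `|DmuF nu mu y| <= Cmu])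
  (D2nunuFP : forall (mu : Prob Y) x, X x ->
    is_flat_derivative (fun nu : Prob X => DnuF nu mu x)
                       (fun nu => D2nunuF nu mu x))
  (D2munuFP : forall (nu : Prob X) x, X x ->
    is_flat_derivative (fun mu : Prob Y => DnuF nu mu x)
                       (fun mu => D2munuF nu mu x))
  (D2mumuFP : forall (nu : Prob X) y, Y y ->
    is_flat_derivative (fun mu : Prob Y => DmuF nu mu y)
                       (fun mu => D2mumuF nu mu y))
  (D2numuFP : forall (mu : Prob Y) y, Y y ->
    is_flat_derivative (fun nu : Prob X => DmuF nu mu y)
                       (fun nu => D2numuF nu mu y))
  (D2F_bounded : exists Cnunu Cmumu Cnumu Cmunu : R,
    [/\ 0 < Cnunu, 0 < Cmumu, 0 < Cnumu, 0 < Cmunu &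
      forall (nu : Prob X) (mu : Prob Y) x x' y y',
        X x -> X x' -> Y y -> Y y' ->
        [/\ `|D2nunuF nu mu x x'| <= Cnunu,
            `|D2mumuF nu mu y y'| <= Cmumu,
            `|D2numuF nu mu y x| <= Cnumu
          & `|D2munuF nu mu x y| <= Cmunu]])
  (nu0 : Prob X) (mu0 : Prob Y) (nu0ac : Pac nu0) (mu0ac : Pac mu0)
  (KL0_fin : (KL nu0 (Psi sigma Upi DnuF nu0 mu0)
            + KL mu0 (Phi sigma Urho DmuF nu0 mu0) < +oo)%E)
  (nu : R -> Prob X) (mu : R -> Prob Y)
  (flow : is_MFBR_flow sigma Upi Urho DnuF DmuF alpha nu0 mu0 nu mu)
  (nus : Prob X) (mus : Prob Y)
  (mne : is_MNE (payoff sigma F ppi prho) nus mus) :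
  forall t : R, 0 <= t ->
    (KL (nu t) nus + KL (mu t) mus <=
      (expR (- (alpha * t)))%:E *
      (KL nu0 (Psi sigma Upi DnuF nu0 mu0)
       + KL mu0 (Phi sigma Urho DmuF nu0 mu0)))%E
    /\
    ((TV (nu t) nus ^+ 2 + TV (mu t) mus ^+ 2)%:E <=
      (2^-1 * expR (- (alpha * t)))%:E *
      (KL nu0 (Psi sigma Upi DnuF nu0 mu0)
       + KL mu0 (Phi sigma Urho DmuF nu0 mu0)))%E.
Proof.
have [Cnu [Cmu [Cnu0 Cmu0 DFb]]] := DF_bounded.
have [Cnunu [Cmumu [Cnumu [Cmunu [C1 C2 C3 C4 D2Fb]]]]] := D2F_bounded.
(* The bounds on the derivatives quantify over points of X and Y jointly, so using one of them
   requires a point of the other set. *)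
have [x0 Xx0] := Prob_nonempty ppi; have [y0 Yy0] := Prob_nonempty prho.
have DnuC a b x : X x -> `|DnuF a b x| <= Cnu by move=> Xx; have [] := DFb a b x y0 Xx Yy0.
have DmuC a b y : Y y -> `|DmuF a b y| <= Cmu by move=> Yy; have [] := DFb a b x0 y Xx0 Yy.
pose beta := 2 / sigma ^+ 2.
have beta0 : 0 < beta by rewrite divr_gt0// exprn_gt0.
have betaV : beta^-1 = sigma ^+ 2 / 2 by rewrite invf_div.
pose gX a b x := beta * DnuF a b x.
pose gY a b y := - (beta * DmuF a b y).
have PsiE a b : Psi_exponent sigma Upi DnuF a b = tilt Upi (gX a b).
  by apply/funext => x; rewrite /Psi_exponent /tilt /gX mulNr.
have PhiE a b : Phi_exponent sigma Urho DmuF a b = tilt Urho (gY a b).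
  by apply/funext => x; rewrite /Phi_exponent /tilt /gY opprK.
have mDnu a b : measurable_fun X (DnuF a b) by exact: flat_derivative_measurable (DnuFP b).
have mDmu a b : measurable_fun Y (DmuF a b) by exact: flat_derivative_measurable (DmuFP a).
have mgX a b : measurable_fun X (gX a b) by exact: measurable_funM.
have mgY a b : measurable_fun Y (gY a b).
  by apply: measurableT_comp => //; exact: measurable_funM.
pose K := beta * (Cnu + Cmu).
have gXK a b x : X x -> `|gX a b x| <= K.
  move=> Xx; rewrite normrM (gtr0_norm beta0) ler_pM2l//.
  by rewrite (le_trans (DnuC a b x Xx))// lerDl ltW.
have gYK a b y : Y y -> `|gY a b y| <= K.
  move=> Yy; rewrite normrN normrM (gtr0_norm beta0) ler_pM2l//.
  by rewrite (le_trans (DmuC a b y Yy))// lerDr ltW.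
have bgX a b : bounded_on X (gX a b) by exists K; exact: gXK.
have bgY a b : bounded_on Y (gY a b) by exists K; exact: gYK.
have iX (p : Prob X) a b : \int[p]_(x in X) gX a b x = beta * \int[p]_(x in X) DnuF a b x.
  by rewrite RintegralZl//; apply: Prob_integrable => //; exists Cnu; exact: DnuC.
have iY (p : Prob Y) a b : \int[p]_(y in Y) gY a b y = - beta * \int[p]_(y in Y) DmuF a b y.
  under eq_Rintegral do rewrite /gY -mulNr.
  by rewrite RintegralZl//; apply: Prob_integrable => //; exists Cmu; exact: DmuC.
have mono (a : Prob X) (b : Prob Y) (a' : Prob X) (b' : Prob Y) :
  ((\int[a]_(x in X) gX a' b' x - \int[a]_(x in X) gX a b x) -
   (\int[a']_(x in X) gX a' b' x - \int[a']_(x in X) gX a b x)) +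
  ((\int[b]_(y in Y) gY a' b' y - \int[b]_(y in Y) gY a b y) -
   (\int[b']_(y in Y) gY a' b' y - \int[b']_(y in Y) gY a b y)) <= 0.
  rewrite !iX !iY.
  (* The two convexity and the two concavity inequalities involve the same alternating sum of the
     four values of F, which cancels. *)
  have := F_convex a a' b; have := F_convex a' a b'.
  have := F_concave a b b'; have := F_concave a' b' b.
  move: (F a' b) (F a b) (F a b') (F a' b') => f1 f2 f3 f4.
  move: (\int[a]_(x in X) DnuF a b x) (\int[a']_(x in X) DnuF a b x)
    (\int[a]_(x in X) DnuF a' b' x) (\int[a']_(x in X) DnuF a' b' x).
  move: (\int[b]_(x in Y) DmuF a b x) (\int[b']_(x in Y) DmuF a b x)
    (\int[b]_(x in Y) DmuF a' b' x) (\int[b']_(x in Y) DmuF a' b' x).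
  move=> v1 v2 v3 v4 u1 u2 u3 u4 H1 H2 H3 H4.
  have -> : (beta * u3 - beta * u1 - (beta * u4 - beta * u2)) +
     (- beta * v3 - - beta * v1 - (- beta * v4 - - beta * v2)) =
     beta * ((u3 - u1 - (u4 - u2)) - (v3 - v1 - (v4 - v2))) by ring.
  by rewrite pmulr_rle0//; lra.
pose L := beta * (Cnunu + Cmumu + Cnumu + Cmunu).
have L0 : 0 <= L by rewrite mulr_ge0// ?ltW// !addr_gt0.
have lip (a : Prob X) (b : Prob Y) (a' : Prob X) (b' : Prob Y) n n' m m' sX sY :
    is_density a n -> is_density a' n' -> is_density b m -> is_density b' m' ->
    (@lebesgue_Rn R d).-integrable X (EFin \o sX) ->
    (@lebesgue_Rn R d).-integrable Y (EFin \o sY) ->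
    (forall x, X x -> `|n' x - n x| <= sX x) -> (forall y, Y y -> `|m' y - m y| <= sY y) ->
    (forall x, X x -> `|gX a' b' x - gX a b x| <=
     L * (\int[@lebesgue_Rn R d]_(x in X) sX x + \int[@lebesgue_Rn R d]_(y in Y) sY y)) /\
    (forall y, Y y -> `|gY a' b' y - gY a b y| <=
     L * (\int[@lebesgue_Rn R d]_(x in X) sX x + \int[@lebesgue_Rn R d]_(y in Y) sY y)).
  move=> an an' bm bm' isX isY sXP sYP.
  have IX0 : 0 <= \int[@lebesgue_Rn R d]_(x in X) sX x.
    by apply: Rintegral_ge0 => x Xx; exact: le_trans (sXP x Xx).
  have IY0 : 0 <= \int[@lebesgue_Rn R d]_(y in Y) sY y.
    by apply: Rintegral_ge0 => x Xx; exact: le_trans (sYP x Xx).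
  split=> z Mz.
  (* One argument is moved at a time, through the intermediate pair (a, b'). *)
  - have H1 : `|DnuF a' b' z - DnuF a b' z| <= Cnunu * \int[@lebesgue_Rn R d]_(x in X) sX x.
      apply: (flat_derivative_lipschitz mX an an' isX sXP (D2nunuFP b' z Mz)).
      by move=> p x Xx; have [] := D2Fb p b' z x y0 y0 Mz Xx Yy0 Yy0.
    have H2 : `|DnuF a b' z - DnuF a b z| <= Cmunu * \int[@lebesgue_Rn R d]_(y in Y) sY y.
      apply: (flat_derivative_lipschitz mY bm bm' isY sYP (D2munuFP a z Mz)).
      by move=> p y Yy; have [] := D2Fb a p z z y y Mz Mz Yy Yy.
    rewrite /gX -mulrBr normrM (gtr0_norm beta0) /L -mulrA ler_pM2l//.
    apply: le_trans (ler_distD (DnuF a b' z) _ _) _.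
    move: H1 H2 IX0 IY0; move: (\int[_]_(x in X) _) (\int[_]_(y in Y) _) => u v.
    move: (`|_|) (`|_|) => e1 e2; nra.
  - have H1 : `|DmuF a' b' z - DmuF a b' z| <= Cnumu * \int[@lebesgue_Rn R d]_(x in X) sX x.
      apply: (flat_derivative_lipschitz mX an an' isX sXP (D2numuFP b' z Mz)).
      by move=> p x Xx; have [] := D2Fb p b' x x z z Xx Xx Mz Mz.
    have H2 : `|DmuF a b' z - DmuF a b z| <= Cmumu * \int[@lebesgue_Rn R d]_(y in Y) sY y.
      apply: (flat_derivative_lipschitz mY bm bm' isY sYP (D2mumuFP a z Mz)).
      by move=> p y Yy; have [] := D2Fb a p x0 x0 z y Xx0 Xx0 Mz Yy.
    rewrite /gY -opprD normrN -mulrBr normrM (gtr0_norm beta0) /L -mulrA ler_pM2l//.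
    apply: le_trans (ler_distD (DmuF a b' z) _ _) _.
    move: H1 H2 IX0 IY0; move: (\int[_]_(x in X) _) (\int[_]_(y in Y) _) => u v.
    move: (`|_|) (`|_|) => e1 e2; nra.
have [nusac musac Vmne] := mne.
have [ns nsP] := Pac_density nusac; have [ms msP] := Pac_density musac.
have wX (x : 'rV[R]_d) : X x -> 0 < expR (- Upi x) by move=> _; exact: expR_gt0.
have wY (y : 'rV[R]_d) : Y y -> 0 < expR (- Urho y) by move=> _; exact: expR_gt0.
have EX0 := KL_ge0 mX nsP ppiE wX; have EY0 := KL_ge0 mY msP prhoE wY.
have c0 : 0 < sigma ^+ 2 / 2 by rewrite divr_gt0// exprn_gt0.
have [EXoo EYoo] : (KL nus ppi < +oo)%E /\ (KL mus prho < +oo)%E.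
  (* The chain V (nus, prho) <= V (nus, mus) <= V (ppi, mus) bounds both equilibrium entropies. *)
  have [_ H1] := Vmne ppi prho; have [H2 _] := Vmne ppi prho.
  have := le_trans H2 H1; rewrite /payoff.
  rewrite (KL_same mX ppiE ppiE wX) (KL_same mY prhoE prhoE wY).
  exact: payoff_finite.
have fX : KL nus ppi \is a fin_num by rewrite ge0_fin_numE.
have fY : KL mus prho \is a fin_num by rewrite ge0_fin_numE.
have i0 M : (@lebesgue_Rn R d).-integrable M (EFin \o (fun _ => 0 : R)).
  exact: integrable0.
have I0 M : \int[@lebesgue_Rn R d]_(x in M) (0 : R) = 0.
  by rewrite /Rintegral integral0.
have z0 M (f : 'rV[R]_d -> R) : forall x, M x -> `|f x - f x| <= (fun=> 0) x.
  by move=> x _; rewrite subrr normr0.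
have nusq : is_density nus (gibbs_density X (tilt Upi (gX nus mus))).
  (* The constant is 2 L because mixing with weight e moves the density by at most 2 e in L^1; the
     opponent does not move, so its dominating function is 0. *)
  apply: (@minimizer_gibbs_density R d X mX Upi ppi mUpi Upi1 ppiE
    (fun p => beta * F p mus) (fun p => gX p mus) nus ns (2 * L)) => //.
  - move=> p p'; rewrite !iX -!mulrBr ler_pM2l//; exact: F_convex.
  - move=> p; have [_ +] := Vmne p mus; rewrite /payoff => H.
    have := payoff_minimizer c0 fX fY H.
    by rewrite -betaV invrK.
  - move=> p e x pE e0 e1 Xx.
    have pq : is_density p (gibbs_density X (tilt Upi (gX nus mus))).
      by rewrite pE; exact: gibbs_is_density.
    have mixd := mix_density mX (ltW e0) (ltW e1) nsP pq.
    have [si sI sle] := mix_density_close mX e0 nsP pq.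
    have [+ _] := lip _ _ _ _ _ _ _ _ _ _ nsP mixd msP msP si (i0 Y) sle (z0 Y ms).
    by move=> /(_ x Xx)/le_trans; apply; rewrite sI I0 addr0 mulrCA mulrA.
have musq : is_density mus (gibbs_density Y (tilt Urho (gY nus mus))).
  apply: (@minimizer_gibbs_density R d Y mY Urho prho mUrho Urho1 prhoE
    (fun p => beta * - F nus p) (fun p => gY nus p) mus ms (2 * L)) => //.
  - move=> p p'; rewrite !iY; have := F_concave nus p p'.
    rewrite -(ler_pM2l beta0) !mulrBr !mulNr !mulrN.
    move: (beta * F nus p) (beta * F nus p') => f1 f2.
    by move: (beta * Rintegral p _ _) (beta * Rintegral p' _ _) => u1 u2; lra.
  - move=> p; have [+ _] := Vmne nus p; rewrite /payoff => H.
    have := payoff_maximizer c0 fX fY H.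
    by rewrite -betaV invrK.
  - move=> p e y pE e0 e1 Yy.
    have pq : is_density p (gibbs_density Y (tilt Urho (gY nus mus))).
      by rewrite pE; exact: gibbs_is_density.
    have mixd := mix_density mY (ltW e0) (ltW e1) msP pq.
    have [si sI sle] := mix_density_close mY e0 msP pq.
    have [_ +] := lip _ _ _ _ _ _ _ _ _ _ nsP nsP msP mixd (i0 X) si (z0 X ns) sle.
    by move=> /(_ y Yy)/le_trans; apply; rewrite sI I0 add0r mulrCA mulrA.
have [flow0 flowac [n [m [dens flowX flowY]]]] := flow.
have nun t : 0 <= t -> is_density (nu t) (n t) by move=> /dens[].
have mum t : 0 <= t -> is_density (mu t) (m t) by move=> /dens[].
have flowX' t x : 0 <= t -> X x -> has_derivative_on_nonneg (n ^~ x) t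
    (alpha * (gibbs_density X (tilt Upi (gX (nu t) (mu t))) x - n t x)).
  by move=> t0 Xx; rewrite -PsiE; exact: flowX.
have flowY' t y : 0 <= t -> Y y -> has_derivative_on_nonneg (m ^~ y) t
    (alpha * (gibbs_density Y (tilt Urho (gY (nu t) (mu t))) y - m t y)).
  by move=> t0 Yy; rewrite -PhiE; exact: flowY.
have nu0n : is_density nu0 (n 0).
  have [n1 n2 nE] := nun 0 (lexx 0); split => // A mA AX.
  by have [<- _] := flow0 A mA; exact: nE.
have mu0m : is_density mu0 (m 0).
  have [m1 m2 mE] := mum 0 (lexx 0); split => // A mA AY.
  by have [_ <-] := flow0 A mA; exact: mE.
(* The measures [nu 0] and [nu0] share the density [n 0], and likewise for the other player, so the
   Lipschitz bound with dominating function 0 identifies the potentials. *)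
have [g0X g0Y] : (forall x, X x -> gX (nu 0) (mu 0) x = gX nu0 mu0 x) /\
                 (forall y, Y y -> gY (nu 0) (mu 0) y = gY nu0 mu0 y).
  have [HX HY] := lip _ _ _ _ _ _ _ _ _ _ nu0n (nun 0 (lexx 0)) mu0m (mum 0 (lexx 0))
    (i0 X) (i0 Y) (z0 X _) (z0 Y _).
  split=> z Mz; apply/eqP; rewrite -subr_eq0 -normr_le0.
    by rewrite (le_trans (HX z Mz))// !I0 addr0 mulr0.
  by rewrite (le_trans (HY z Mz))// !I0 addr0 mulr0.
rewrite /Psi /Phi !PsiE !PhiE in KL0_fin *.
move=> t t0; set D0 := (KL nu0 _ + KL mu0 _)%E in KL0_fin *.
have e1 := KL_gibbs_congr (nu 0) nu0 mX mUpi Upi1 (mgX _ _) (bgX _ _) (mgX _ _) (bgX _ _)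
  (nun 0 (lexx 0)) nu0n g0X.
have e2 := KL_gibbs_congr (mu 0) mu0 mY mUrho Urho1 (mgY _ _) (bgY _ _) (mgY _ _) (bgY _ _)
  (mum 0 (lexx 0)) mu0m g0Y.
have V0E : D0 = (_ + _)%E := esym (f_equal2 (fun a b => (a + b)%E) e1 e2).
clearbody D0; rewrite {}V0E {D0} in KL0_fin *.
have decay := lyapunov_decay mX mY mUpi mUrho Upi1 Urho1 ppiE prhoE L0 mgX mgY gXK gYK
  mono lip alpha_gt0 nun mum flowX' flowY' t0.
have := KL_equilibrium_le mX mY mUpi mUrho Upi1 Urho1 ppiE prhoE mgX mgY gXK gYK mono
  (nun t t0) (mum t t0) nusq musq.
move=> /le_trans/(_ (decay KL0_fin)) main; split => //.
have q0X x : X x -> 0 < gibbs_density X (tilt Upi (gX nus mus)) x.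
  by move=> _; exact: gibbs_density_gt0.
have q0Y y : Y y -> 0 < gibbs_density Y (tilt Urho (gY nus mus)) y.
  by move=> _; exact: gibbs_density_gt0.
have TVX := pinsker mX (nun t t0) nusq q0X.
have TVY := pinsker mY (mum t t0) musq q0Y.
rewrite EFinD (le_trans (leeD TVX TVY))// -muleDr//; last first.
  by rewrite ge0_adde_def// inE (KL_ge0 _ (nun t t0) nusq, KL_ge0 _ (mum t t0) musq).
by rewrite EFinM -muleA lee_pmul2l// lte_fin invr_gt0.
Qed.
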